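(* Let $\mathsf{L}$ be one of the logics $\mathbf{PD}$, $\mathbf{PD}^{\vee}$, $\mathbf{PID}$, and let $\vdash_{\mathsf{L}}$ be derivability in the deduction system for $\mathsf{L}$ given in the context. Then the system is sound and strongly complete: for every set $\Gamma\cup\{\phi\}$ of formulas in the language of $\mathsf{L}$, $$\Gamma\vdash_{\mathsf{L}}\phi\iff\Gamma\models\phi.$$
   Context: **Semantics.** Propositional variables are $p_i$, $i\in\mathbb{N}$. A valuation is a function $s:\mathbb{N}\to\{0,1\}$; a team is a set of valuations. Truth of a formula on a team $X$: - $X\models p_i$ iff $s(i)=1$ for all $s\in X$; $X\models\neg p_i$ iff $s(i)=0$ for all $s\in X$; $X\models\bot$ iff $X=\emptyset$; - $X\models\mathop{=}(p_{i_1},\dots,p_{i_k},p_j)$ ($k\ge0$) iff for all $s,s'\in X$, if $s(i_1)=s'(i_1),\dots,s(i_k)=s'(i_k)$ then $s(j)=s'(j)$; - $X\models\phi\wedge\psi$ iff $X\models\phi$ and $X\models\psi$; - $X\models\phi\otimes\psi$ iff there are $Y,Z\subseteq X$ with $X=Y\cup Z$, $Y\models\phi$, $Z\models\psi$; - $X\models\phi\vee\psi$ iff $X\models\phi$ or $X\models\psi$; - $X\models\phi\to\psi$ iff for all $Y\subseteq X$, $Y\models\phi$ implies $Y\models\psi$. $\Gamma\models\phi$ means: every team on which all formulas of $\Gamma$ are true makes $\phi$ true. **Languages.** $\mathbf{PD}$: atoms $p_i,\neg p_i,\bot,\mathop{=}(p_{i_1},\dots,p_{i_k},p_j)$, connectives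 $\wedge,\otimes$. $\mathbf{PD}^{\vee}$: atoms $p_i,\neg p_i,\bot$, connectives $\wedge,\otimes,\vee$. $\mathbf{PID}$: atoms $p_i,\bot,\mathop{=}(p_{i_1},\dots,p_{i_k},p_j)$, connectives $\wedge,\vee,\to$, with $\neg\phi:=\phi\to\bot$ and $\phi\leftrightarrow\psi:=(\phi\to\psi)\wedge(\psi\to\phi)$. In $\mathbf{PD}$ and $\mathbf{PD}^\vee$ a classical formula is one built from $p_i,\neg p_i,\bot$ using only $\wedge,\otimes$. In all systems, axioms and rules written with $p_i$, $p_j$ or dependence atoms apply to propositional variables only (they are not schemata), while $\phi,\psi,\chi,\theta$ range over arbitrary formulas of the language. There is no substitution rule. $\Gamma\vdash_{\mathsf{L}}\phi$ means there is a derivation of $\phi$ whose (undischarged) hypotheses are in $\Gamma$. **System for $\mathbf{PID}$ (Hilbert style).** Axioms: (1) all substitution instances, in the language of $\mathbf{PID}$, of the axioms of a standard Hilbert system for intuitionistic propositional logic with modus ponens; (2) for all $k$, all instances of $\bigl(\neg\psi\to\bigvee_{1\le i\le k}\neg\chi_i\bigr)\to\bigvee_{1\le i\le k}(\neg\psi\to\neg\chi_i)$, with $\psi,\chi_i$ arbitrary formulas; (3) $\neg\neg p_i\to p_i$; (4) $\mathop{=}(p_i)\leftrightarrow(p_i\vee\neg p_i)$; (5) $\mathop{=}(p_{i_1},\dots,p_{i_k},p_j)\leftrightarrow\bigl((\mathop{=}(p_{i_1})\wedge\dots\wedge\mathop{=}(p_{i_k}))\to\mathop{=}(p_j)\bigr)$.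 Rule: from $\phi\to\psi$ and $\phi$ infer $\psi$. **Natural deduction system for $\mathbf{PD}^{\vee}$.** Axiom: $p_i\otimes\neg p_i$. Rules: - from $\phi$ and $\psi$ infer $\phi\wedge\psi$; from $\phi\wedge\psi$ infer $\phi$, and infer $\psi$; - from $\phi$ infer $\phi\vee\psi$; from $\psi$ infer $\phi\vee\psi$; from $\phi\vee\psi$, a derivation of $\chi$ from $\phi$ and a derivation of $\chi$ from $\psi$, infer $\chi$, discharging these assumptions $\phi$, $\psi$; - from $\phi$ infer $\phi\otimes\psi$; from $\psi$ infer $\phi\otimes\psi$; - (weak elimination) if $\alpha$ is a classical formula: from $\phi\otimes\psi$, a derivation of $\alpha$ from $\phi$ and a derivation of $\alpha$ from $\psi$, infer $\alpha$, discharging $\phi$, $\psi$; - (substitution) from $\phi\otimes\psi$ and a derivation of $\chi$ from $\psi$, infer $\phi\otimes\chi$, discharging $\psi$; - from $\phi\otimes\psi$ infer $\psi\otimes\phi$; from $\phi\otimes(\psi\otimes\chi)$ infer $(\phi\otimes\psi)\otimes\chi$; - from $p_i\wedge\neg p_i$ infer $\bot$; from $\phi\otimes\bot$ infer $\phi$; - (distributivity) from $\phi\otimes(\psi\vee\chi)$ infer $(\phi\otimes\psi)\vee(\phi\otimes\chi)$. The sub-derivations in discharging rules may use further undischarged hypotheses. **Natural deduction system for $\mathbf{PD}$.** The axiom $p_i\otimes\neg p_i$ and all the rules of the system for $\mathbf{PD}^{\vee}$ that do not mention $\vee$ (applied to formulas of $\mathbf{PD}$), together with: - from $p_i$ infer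 $\mathop{=}(p_i)$; from $\neg p_i$ infer $\mathop{=}(p_i)$; - from a derivation of $\mathop{=}(p_j)$ from assumptions $\mathop{=}(p_{i_1}),\dots,\mathop{=}(p_{i_k})$, infer $\mathop{=}(p_{i_1},\dots,p_{i_k},p_j)$, discharging these assumptions; - from $\mathop{=}(p_i)$, a derivation of $\theta$ from $p_i$ and a derivation of $\theta$ from $\neg p_i$, infer $\theta$, discharging $p_i$, $\neg p_i$; - from $\mathop{=}(p_{i_1},\dots,p_{i_k},p_j)$, $\mathop{=}(p_{i_1}),\dots,\mathop{=}(p_{i_k})$ infer $\mathop{=}(p_j)$; - (strong elimination) given a particular occurrence of an atom $\mathop{=}(p_i)$ in $\phi$, let $\phi^{1}$ and $\phi^0$ be the results of replacing that occurrence in $\phi$ by $p_i$ and by $\neg p_i$ respectively: from $\phi$, a derivation of $\theta$ from $\phi^1$ and a derivation of $\theta$ from $\phi^0$, infer $\theta$, discharging $\phi^1$, $\phi^0$. *)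

(* Defs.v *)
From mathcomp Require Import all_boot.
From mathcomp Require Import boolp classical_sets.

Set Implicit Arguments.
Unset Strict Implicit.
Unset Printing Implicit Defensive.

Local Open Scope classical_set_scope.

(* One common syntax for the three logics; [in_lang] below carves out the
   language of each. [FDep [:: i1; ..; ik] j] is the dependence atom
   =(p_i1, .., p_ik, p_j), so =(p_j) is [FDep [::] j]. [FNegVar i] is the
   atomic negation of PD and PDv, as opposed to the defined negation [fneg]
   of PID. *)
Inductive form : Type :=
| FVar of nat
| FNegVar of nat
| FBot
| FDep of seq nat & nat
| FAnd of form & form
| FTensor of form & form
| FOr of form & form
| FImp of form & form.

Definition valuation := nat -> bool.
Definition team := set valuation.

Fixpoint sat (X : team) (phi : form) : Prop :=
  match phi with
  | FVar i => forall s, X s -> s i = true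
  | FNegVar i => forall s, X s -> s i = false
  | FBot => X = set0
  | FDep ks j => forall s s', X s -> X s' ->
      (forall i, i \in ks -> s i = s' i) -> s j = s' j
  | FAnd phi psi => sat X phi /\ sat X psi
  | FTensor phi psi => exists Y Z : team,
      [/\ Y `<=` X, Z `<=` X, X = Y `|` Z, sat Y phi & sat Z psi]
  | FOr phi psi => sat X phi \/ sat X psi
  | FImp phi psi => forall Y : team, Y `<=` X -> sat Y phi -> sat Y psi
  end.

Definition entails (Gamma : set form) (phi : form) : Prop :=
  forall X : team, (forall psi, Gamma psi -> sat X psi) -> sat X phi.

Inductive logic : Type := PD | PDv | PID.

Fixpoint in_PD (phi : form) : bool :=
  match phi with
  | FVar _ | FNegVar _ | FBot | FDep _ _ => true
  | FAnd phi psi | FTensor phi psi => in_PD phi && in_PD psi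
  | FOr _ _ | FImp _ _ => false
  end.

Fixpoint in_PDv (phi : form) : bool :=
  match phi with
  | FVar _ | FNegVar _ | FBot => true
  | FAnd phi psi | FTensor phi psi | FOr phi psi => in_PDv phi && in_PDv psi
  | FDep _ _ | FImp _ _ => false
  end.

Fixpoint in_PID (phi : form) : bool :=
  match phi with
  | FVar _ | FBot | FDep _ _ => true
  | FAnd phi psi | FOr phi psi | FImp phi psi => in_PID phi && in_PID psi
  | FNegVar _ | FTensor _ _ => false
  end.

Definition in_lang (L : logic) : form -> bool :=
  match L with PD => in_PD | PDv => in_PDv | PID => in_PID end.

Fixpoint classical (phi : form) : bool :=
  match phi with
  | FVar _ | FNegVar _ | FBot => true
  | FAnd phi psi | FTensor phi psi => classical phi && classical psi
  | FDep _ _ | FOr _ _ | FImp _ _ => false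
  end.

Definition fneg (phi : form) : form := FImp phi FBot.

Definition fiff (phi psi : form) : form := FAnd (FImp phi psi) (FImp psi phi).

(* Nonempty finite disjunctions and conjunctions, bracketed to the right. *)
Fixpoint big_or (chi : form) (chis : seq form) : form :=
  if chis is chi' :: chis' then FOr chi (big_or chi' chis') else chi.

Fixpoint big_and (chi : form) (chis : seq form) : form :=
  if chis is chi' :: chis' then FAnd chi (big_and chi' chis') else chi.

Inductive int_axiom : form -> Prop :=
| int_K phi psi : int_axiom (FImp phi (FImp psi phi))
| int_S phi psi chi :
    int_axiom (FImp (FImp phi (FImp psi chi))
                    (FImp (FImp phi psi) (FImp phi chi)))
| int_andI phi psi : int_axiom (FImp phi (FImp psi (FAnd phi psi)))
| int_andEl phi psi : int_axiom (FImp (FAnd phi psi) phi)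
| int_andEr phi psi : int_axiom (FImp (FAnd phi psi) psi)
| int_orIl phi psi : int_axiom (FImp phi (FOr phi psi))
| int_orIr phi psi : int_axiom (FImp psi (FOr phi psi))
| int_orE phi psi chi :
    int_axiom (FImp (FImp phi chi)
                    (FImp (FImp psi chi) (FImp (FOr phi psi) chi)))
| int_botE phi : int_axiom (FImp FBot phi).

(* The disjunction in [PID_split] has k >= 1 disjuncts: read with an empty
   disjunction equal to FBot, the case k = 0 would be unsound. The case k = 0
   of the dependence axiom, which speaks of =(p_j) alone, is [PID_dep0]. *)
Inductive PID_axiom : form -> Prop :=
| PID_int phi : int_axiom phi -> PID_axiom phi
| PID_split psi chi chis :
    PID_axiom
      (FImp (FImp (fneg psi) (big_or (fneg chi) [seq fneg x | x <- chis]))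
            (big_or (FImp (fneg psi) (fneg chi))
                    [seq FImp (fneg psi) (fneg x) | x <- chis]))
| PID_dne i : PID_axiom (FImp (fneg (fneg (FVar i))) (FVar i))
| PID_dep0 i :
    PID_axiom (fiff (FDep [::] i) (FOr (FVar i) (fneg (FVar i))))
| PID_dep i ks j :
    PID_axiom
      (fiff (FDep (i :: ks) j)
            (FImp (big_and (FDep [::] i) [seq FDep [::] x | x <- ks])
                  (FDep [::] j))).

Inductive hilbert (Gamma : set form) : form -> Prop :=
| hilbert_hyp phi : in_PID phi -> Gamma phi -> hilbert Gamma phi
| hilbert_ax phi : in_PID phi -> PID_axiom phi -> hilbert Gamma phi
| hilbert_mp phi psi :
    hilbert Gamma (FImp phi psi) -> hilbert Gamma phi -> hilbert Gamma psi.

(* Formulas with one hole, used to single out an occurrence of an atom. Only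
   the connectives of PD are needed. *)
Inductive ctx : Type :=
| CHole
| CAndl of ctx & form
| CAndr of form & ctx
| CTensorl of ctx & form
| CTensorr of form & ctx.

Fixpoint fill (C : ctx) (chi : form) : form :=
  match C with
  | CHole => chi
  | CAndl C psi => FAnd (fill C chi) psi
  | CAndr psi C => FAnd psi (fill C chi)
  | CTensorl C psi => FTensor (fill C chi) psi
  | CTensorr psi C => FTensor psi (fill C chi)
  end.

(* [nd L Gamma phi]: phi has a natural deduction derivation in L (PD or PDv)
   whose undischarged hypotheses lie in Gamma; a discharged assumption is one
   added to Gamma in a premise. The [in_lang] side conditions appear where a
   rule brings in a formula that is not part of its premises, so that every
   formula in a derivation belongs to the language of L. *)
Inductive nd (L : logic) : set form -> form -> Prop :=
| nd_hyp Gamma phi : in_lang L phi -> Gamma phi -> nd L Gamma phi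
| nd_em Gamma i : nd L Gamma (FTensor (FVar i) (FNegVar i))
| nd_andI Gamma phi psi :
    nd L Gamma phi -> nd L Gamma psi -> nd L Gamma (FAnd phi psi)
| nd_andEl Gamma phi psi : nd L Gamma (FAnd phi psi) -> nd L Gamma phi
| nd_andEr Gamma phi psi : nd L Gamma (FAnd phi psi) -> nd L Gamma psi
| nd_tensorIl Gamma phi psi :
    in_lang L psi -> nd L Gamma phi -> nd L Gamma (FTensor phi psi)
| nd_tensorIr Gamma phi psi :
    in_lang L phi -> nd L Gamma psi -> nd L Gamma (FTensor phi psi)
| nd_tensorE Gamma phi psi alpha :
    classical alpha ->
    nd L Gamma (FTensor phi psi) ->
    nd L (phi |` Gamma) alpha -> nd L (psi |` Gamma) alpha ->
    nd L Gamma alpha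
| nd_tensor_sub Gamma phi psi chi :
    nd L Gamma (FTensor phi psi) -> nd L (psi |` Gamma) chi ->
    nd L Gamma (FTensor phi chi)
| nd_tensorC Gamma phi psi :
    nd L Gamma (FTensor phi psi) -> nd L Gamma (FTensor psi phi)
| nd_tensorA Gamma phi psi chi :
    nd L Gamma (FTensor phi (FTensor psi chi)) ->
    nd L Gamma (FTensor (FTensor phi psi) chi)
| nd_contra Gamma i :
    nd L Gamma (FAnd (FVar i) (FNegVar i)) -> nd L Gamma FBot
| nd_botE Gamma phi : nd L Gamma (FTensor phi FBot) -> nd L Gamma phi
| nd_orIl Gamma phi psi :
    L = PDv -> in_lang L psi -> nd L Gamma phi -> nd L Gamma (FOr phi psi)
| nd_orIr Gamma phi psi :
    L = PDv -> in_lang L phi -> nd L Gamma psi -> nd L Gamma (FOr phi psi)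
| nd_orE Gamma phi psi chi :
    L = PDv ->
    nd L Gamma (FOr phi psi) ->
    nd L (phi |` Gamma) chi -> nd L (psi |` Gamma) chi ->
    nd L Gamma chi
| nd_distr Gamma phi psi chi :
    L = PDv ->
    nd L Gamma (FTensor phi (FOr psi chi)) ->
    nd L Gamma (FOr (FTensor phi psi) (FTensor phi chi))
| nd_dep0I1 Gamma i :
    L = PD -> nd L Gamma (FVar i) -> nd L Gamma (FDep [::] i)
| nd_dep0I0 Gamma i :
    L = PD -> nd L Gamma (FNegVar i) -> nd L Gamma (FDep [::] i)
| nd_depI Gamma (ks : seq nat) j :
    L = PD ->
    nd L ([set FDep [::] i | i in [set` ks]] `|` Gamma) (FDep [::] j) ->
    nd L Gamma (FDep ks j)
| nd_dep0E Gamma i theta :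
    L = PD ->
    nd L Gamma (FDep [::] i) ->
    nd L (FVar i |` Gamma) theta -> nd L (FNegVar i |` Gamma) theta ->
    nd L Gamma theta
| nd_depE Gamma ks j :
    L = PD ->
    nd L Gamma (FDep ks j) ->
    (forall i, i \in ks -> nd L Gamma (FDep [::] i)) ->
    nd L Gamma (FDep [::] j)
| nd_strongE Gamma C i theta :
    L = PD ->
    nd L Gamma (fill C (FDep [::] i)) ->
    nd L (fill C (FVar i) |` Gamma) theta ->
    nd L (fill C (FNegVar i) |` Gamma) theta ->
    nd L Gamma theta.

Definition derives (L : logic) (Gamma : set form) (phi : form) : Prop :=
  match L with
  | PD | PDv => nd L Gamma phi
  | PID => hilbert Gamma phi
  end.

(* Main.v *)
From HB Require Import structures.
Require Import Defs.
From mathcomp Require Import all_boot.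
From mathcomp Require Import boolp classical_sets.

(* Every formula phi has a finite list of resolutions: formulas without
   dependence atoms and intuitionistic disjunctions, hence flat (true on a team
   iff true on each of its points), such that phi is provably equivalent to
   their disjunction, in the sense that each resolution derives phi and that
   proofs by cases over the resolutions of phi are admissible. Suppose that
   Gamma does not derive phi and let Delta extend Gamma and be maximal with that
   property. Proof by cases puts a resolution of each member of Gamma into
   Delta. Hence the team X of all points satisfying the flat members of Delta
   satisfies Gamma. If X satisfied phi, it would satisfy a resolution of phi,
   which by completeness for flat formulas, a matter of classical logic, Delta
   would derive. *)

Set Implicit Arguments.
Unset Strict Implicit.
Unset Printing Implicit Defensive.

Local Open Scope classical_set_scope.

(** PD and PDv have neither implication nor negation of compound formulas, so there is no deduction
    theorem and no use for maximal consistent sets. Maximality is therefore relative to the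
    unprovable formula: a formula outside [Delta] yields that formula together with [Delta]. This
    also copes with infinite [Gamma]: no resolutions of its members are chosen in advance, and
    finiteness of derivations enters only through chains in Zorn's lemma.

    Case analysis on a variable that the hypotheses leave open is sound in general only for flat
    conclusions; otherwise every variable would be constant on every team. Hence [Delta] need not
    decide the variables when [phi] is not flat, and the countermodel is a team and not one
    valuation. For a flat goal a maximal set does decide them, which reduces completeness for flat
    formulas to a single valuation.

    What differs between the systems is the source of case analysis over resolutions: strong
    elimination in PD, distributivity in PDv, the split axiom in PID. *)

HB.instance Definition _ := gen_eqMixin form.

Implicit Types (phi psi chi theta alpha : form) (X Y Z : team).
Implicit Types (Gamma Delta : set form).

(** * Team semantics *)

(** Downward closure: it lets hypotheses be reused on the halves of a tensor and on single
    points. *)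
Lemma sat_sub phi X Y : Y `<=` X -> sat X phi -> sat Y phi.
Proof.
elim: phi X Y => [i|i||ks j|phi IHphi psi IHpsi|phi IHphi psi IHpsi
  |phi IHphi psi IHpsi|phi IHphi psi IHpsi] X Y YX /=.
- by move=> h s /YX; apply: h.
- by move=> h s /YX; apply: h.
- by move=> XE; rewrite -subset0 -XE.
- by move=> h s s' /YX Xs /YX; apply: h.
- by move=> [/(IHphi _ _ YX) ? /(IHpsi _ _ YX)].
- move=> [A [B [_ _ XE satA satB]]]; exists (A `&` Y), (B `&` Y); split.
  + exact: subIsetr.
  + exact: subIsetr.
  + by rewrite -setIUl -XE setIidr.
  + exact: IHphi satA.
  + exact: IHpsi satB.
- by move=> [/(IHphi _ _ YX)|/(IHpsi _ _ YX)]; [left|right].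
- by move=> h Z ZY; apply: h; apply: subset_trans YX.
Qed.

Lemma sat_set0 phi : sat set0 phi.
Proof.
elim: phi => //=.
- by move=> phi h psi h'; exists set0, set0; split=> //; rewrite setU0.
- by move=> phi h psi h'; left.
- by move=> phi _ psi h' Y; rewrite subset0 => -> _.
Qed.

(** One syntactic criterion for all three languages: within PD and PDv it picks out the classical
    formulas, within PID those without disjunctions and dependence atoms. *)
Fixpoint flat phi : bool :=
  match phi with
  | FVar _ | FNegVar _ | FBot => true
  | FAnd phi psi | FTensor phi psi | FImp phi psi => flat phi && flat psi
  | FDep _ _ | FOr _ _ => false
  end.

Lemma classical_flat phi : classical phi -> flat phi.
Proof. by elim: phi => //= phi hphi psi hpsi /andP[/hphi-> /hpsi]. Qed.

Lemma flat_classical L alpha :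
  L <> PID -> in_lang L alpha -> flat alpha -> classical alpha.
Proof.
case: L => // _; elim: alpha => //= phi hphi psi hpsi;
  by move=> /andP[/hphi {}hphi /hpsi {}hpsi] /andP[/hphi-> /hpsi].
Qed.

Lemma sat_point phi X s : X s -> sat X phi -> sat [set s] phi.
Proof. by move=> Xs; apply: sat_sub => _ ->. Qed.

Lemma sat_point_tensor phi psi s :
  sat [set s] (FTensor phi psi) <-> sat [set s] phi \/ sat [set s] psi.
Proof.
split=> [[A [B [_ _ sAB satA satB]]]|].
  have : (A `|` B) s by rewrite -sAB.
  by case=> [As|Bs]; [left; apply: sat_point satA|right; apply: sat_point satB].
case=> h; [exists [set s], set0|exists set0, [set s]]; split=> //;
  by rewrite ?setU0 ?set0U //; apply: sat_set0.
Qed.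

Lemma sat_point_imp phi psi s :
  sat [set s] (FImp phi psi) <-> (sat [set s] phi -> sat [set s] psi).
Proof.
split=> [h|h Y Ys satY]; first exact: h.
have [->|/set0P[t Yt]] := eqVneq Y set0; first exact: sat_set0.
apply: (sat_sub Ys); apply: h; have <- : t = s by apply: Ys.
exact: sat_point satY.
Qed.

(** At a tensor the team is cut into the points satisfying either side; at an implication downward
    closure hands the antecedent to each point of the subteam. *)
Lemma sat_flat alpha X :
  flat alpha -> (forall s, X s -> sat [set s] alpha) -> sat X alpha.
Proof.
elim: alpha X => [i|i||//|phi IHphi psi IHpsi|phi IHphi psi IHpsi
  |//|phi IHphi psi IHpsi] X /=.
- by move=> _ h s /h; apply.
- by move=> _ h s /h; apply.
- move=> _ h; rewrite -subset0 => s /h /= s0.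
  by have : [set s] s by []; rewrite s0.
- by move=> /andP[fphi fpsi] h; split; [apply: IHphi|apply: IHpsi] => // s /h[].
- move=> /andP[fphi fpsi] h.
  exists (X `&` [set s | sat [set s] phi]), (X `&` [set s | sat [set s] psi]).
  split; try exact: subIsetl.
  + rewrite -setIUr setIidl // => s /h; exact: (sat_point_tensor _ _ _).1.
  + by apply: IHphi => // s [].
  + by apply: IHpsi => // s [].
- move=> /andP[fphi fpsi] h Y YX satY; apply: IHpsi => // s Ys.
  move: (h _ (YX _ Ys)) => /sat_point_imp; apply; exact: sat_point satY.
Qed.

(** * Soundness *)

(** The hole occurs once, so it is evaluated on a single subteam. On that subteam p_i is constant,
    and its value there settles the alternative for the whole formula. *)
Lemma sat_fill_dep0 C i X : sat X (fill C (FDep [::] i)) ->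
  sat X (fill C (FVar i)) \/ sat X (fill C (FNegVar i)).
Proof.
elim: C X => [|C IH psi|psi C IH|C IH psi|psi C IH] X /=.
- move=> h; have [->|/set0P[t Xt]] := eqVneq X set0; first by left.
  case ti: (t i); [left|right] => s Xs; by rewrite -ti; apply: h.
- by move=> [/IH[]]; [left|right].
- by move=> [? /IH[]]; [left|right].
- by move=> [Y [Z [? ? ? /IH[] ? ?]]]; [left|right]; exists Y, Z.
- by move=> [Y [Z [? ? ? ? /IH[] ?]]]; [left|right]; exists Y, Z.
Qed.

Lemma sat_setU1 Gamma phi X : (forall psi, Gamma psi -> sat X psi) ->
  sat X phi -> forall psi, (phi |` Gamma) psi -> sat X psi.
Proof. by move=> satG ? psi [->|/satG]. Qed.

(** Dependence seen as an implication between constancy atoms, the form behind the dependence rules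
    and the last PID axiom. Two-point teams suffice for the converse, since dependence is a
    condition on pairs of points. *)
Lemma sat_dep_subteams X ks j : sat X (FDep ks j) <->
  (forall Y, Y `<=` X -> (forall i, i \in ks -> sat Y (FDep [::] i)) ->
   sat Y (FDep [::] j)).
Proof.
split=> [h Y YX satY s s' Ys Ys' _|h s s' Xs Xs' ss'].
  by apply: h (YX _ Ys) (YX _ Ys') _ => i /satY; apply.
apply: (h [set s; s']); [by move=> t [->|->]| |by left|by right|by []].
by move=> i /ss' ii t t' [->|->] [->|->].
Qed.

Lemma nd_sound L Gamma phi : nd L Gamma phi -> entails Gamma phi.
Proof.
elim=> {Gamma phi}.
- by move=> Gamma phi _ Gphi X; apply.
- move=> Gamma i X _; apply: sat_flat => // s _.
  by apply/sat_point_tensor; case si: (s i); [left|right] => _ ->.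
- by move=> Gamma phi psi _ h _ h' X satG; split; [apply: h|apply: h'].
- by move=> Gamma phi psi _ h X /h[].
- by move=> Gamma phi psi _ h X /h[].
- move=> Gamma phi psi _ _ h X /h satX; exists X, set0; split=> //.
    by rewrite setU0.
  exact: sat_set0.
- move=> Gamma phi psi _ _ h X /h satX; exists set0, X; split=> //.
    by rewrite set0U.
  exact: sat_set0.
- move=> Gamma phi psi alpha /classical_flat flata _ h _ h1 _ h2 X satG.
  have [Y [Z [YX ZX XE satY satZ]]] := h _ satG.
  (* The conclusion is classical, hence flat, so each point can use the half of the team in which it
     lies. *)
  apply: sat_flat => // s; rewrite XE => -[Ys|Zs].
    by apply: (sat_point Ys); apply: h1; apply: sat_setU1 => // psi' /satG;
       apply: sat_sub.
  by apply: (sat_point Zs); apply: h2; apply: sat_setU1 => // psi' /satG;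
     apply: sat_sub.
- move=> Gamma phi psi chi _ h _ h1 X satG.
  have [Y [Z [YX ZX XE satY satZ]]] := h _ satG.
  exists Y, Z; split=> //; apply: h1; apply: sat_setU1 => // psi' /satG.
  exact: sat_sub.
- move=> Gamma phi psi _ h X /h[Y [Z [? ? XE ? ?]]].
  by exists Z, Y; split; rewrite // setUC.
- move=> Gamma phi psi chi _ h X /h[A [B [AX BX XE satA [C [D]]]]].
  case=> CB DB BE satC satD.
  exists (A `|` C), D; split=> //.
  + by move=> s [/AX//|/CB/BX].
  + by apply: subset_trans BX.
  + by rewrite -setUA -BE.
  + by exists A, C; split.
- move=> Gamma i _ h X /h[hi hni]; rewrite /= -subset0 => s Xs.
  by have := hi s Xs; rewrite hni.
- by move=> Gamma phi _ h X /h[Y [Z [_ _ -> satY ->]]]; rewrite setU0.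
- by move=> Gamma phi psi _ _ _ h X /h; left.
- by move=> Gamma phi psi _ _ _ h X /h; right.
- move=> Gamma phi psi chi _ _ h _ h1 _ h2 X satG.
  by case: (h _ satG) => ?; [apply: h1|apply: h2]; apply: sat_setU1.
- move=> Gamma phi psi chi _ _ h X /h[Y [Z [? ? ? ? []]]] ?.
    by left; exists Y, Z.
  by right; exists Y, Z.
- by move=> Gamma i _ _ h X /h hi s s' Xs Xs' _; rewrite !hi.
- by move=> Gamma i _ _ h X /h hi s s' Xs Xs' _; rewrite !hi.
- move=> Gamma ks j _ _ h X satG; apply/sat_dep_subteams => Y YX satY.
  apply: h => psi [[i iks <-]|/satG]; [exact: satY|exact: sat_sub].
- move=> Gamma i theta _ _ h _ h1 _ h2 X satG.
  case: (@sat_fill_dep0 CHole _ _ (h _ satG)) => ?;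
    by [apply: h1; apply: sat_setU1|apply: h2; apply: sat_setU1].
- move=> Gamma ks j _ _ h _ h' X satG.
  have /sat_dep_subteams := h _ satG; apply => // i iks; exact: h'.
- move=> Gamma C i theta _ _ h _ h1 _ h2 X satG.
  case: (sat_fill_dep0 (h _ satG)) => ?;
    by [apply: h1; apply: sat_setU1|apply: h2; apply: sat_setU1].
Qed.

Lemma sat_neg phi X :
  sat X (fneg phi) <-> forall s, X s -> ~ sat [set s] phi.
Proof.
split=> [h s Xs satp|h Y YX satY].
  have s0 : [set s] = set0 by apply: h => // _ ->.
  by have : [set s] s by []; rewrite s0.
by rewrite /= -subset0 => s Ys; case: (h s (YX _ Ys)); apply: sat_point satY.
Qed.

Lemma sat_big_or X chi chis : sat X (big_or chi chis) <->
  exists2 psi, psi \in chi :: chis & sat X psi.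
Proof.
elim: chis chi => [|psi chis IH] chi /=.
  split=> [|[psi]]; first by exists chi; rewrite ?mem_seq1.
  by rewrite mem_seq1 => /eqP->.
split=> [[?|/IH[theta ? ?]]|[theta]].
- by exists chi; rewrite ?mem_head.
- by exists theta; rewrite // in_cons; apply/orP; right.
- by rewrite in_cons => /orP[/eqP->|? ?]; [left|right; apply/IH; exists theta].
Qed.

Lemma sat_big_and_dep X i ks :
  sat X (big_and (FDep [::] i) [seq FDep [::] x | x <- ks]) <->
  forall k, k \in i :: ks -> sat X (FDep [::] k).
Proof.
elim: ks i => [|k ks IH] i.
  by split=> [h k|]; [rewrite mem_seq1 => /eqP->|apply; rewrite mem_head].
split=> [[h /IH h'] k'|h].
  by rewrite in_cons => /orP[/eqP->//|/h'].
split; first by apply: h; rewrite mem_head.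
by apply/IH => k' hk'; apply: h; rewrite in_cons hk' orbT.
Qed.

Lemma PID_axiom_sound X phi : PID_axiom phi -> sat X phi.
Proof.
case=> {phi}.
- move=> _ [] /=.
  + by move=> phi psi Y YX satY Z ZY _; apply: sat_sub satY.
  + move=> phi psi chi Y YX h Z ZY h' A AZ h''.
    by apply: (h _ (subset_trans AZ ZY) h'' A) => //; apply: h'.
  + by move=> phi psi Y YX satY Z ZY ?; split=> //; apply: sat_sub satY.
  + by move=> phi psi Y YX [].
  + by move=> phi psi Y YX [].
  + by move=> phi psi Y YX; left.
  + by move=> phi psi Y YX; right.
  + move=> phi psi chi Y YX h Z ZY h' A AZ [?|?].
      by apply: h => //; apply: subset_trans ZY.
    exact: h'.
  + by move=> phi Y YX ->; apply: sat_set0.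
- move=> psi chi chis Y YX h.
  (* [A] is the largest subteam of [Y] on which [fneg psi] holds. The disjunct true on [A] is
     inherited by every subteam of [Y] satisfying [fneg psi], so it serves uniformly. *)
  set A : team := Y `&` [set s | ~ sat [set s] psi].
  have /sat_big_or[theta] : sat A (big_or (fneg chi) [seq fneg x | x <- chis]).
    by apply: h; [exact: subIsetl|apply/sat_neg => s []].
  rewrite -(map_cons fneg) => /mapP[x xin ->] satx; apply/sat_big_or.
  exists (FImp (fneg psi) (fneg x)).
    by rewrite -(map_cons (fun x => FImp _ (fneg x))) map_f.
  move=> Z ZY /sat_neg hZ; apply: sat_sub satx => s Zs.
  by split; [apply: ZY|apply: hZ].
- move=> i Y YX h s Ys; case si: (s i) => //.
  case: ((sat_neg (fneg (FVar i)) Y).1 h s Ys).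
  by apply/sat_neg => _ -> /(_ _ erefl); rewrite si.
- move=> i; split=> Y YX.
    move=> hY; case: (@sat_fill_dep0 CHole _ _ hY) => [?|h]; [by left|right].
    by apply/(sat_neg (FVar i)) => s /h si /(_ _ erefl); rewrite si.
  case=> [h|h] s s' Ys Ys' _; first by rewrite !h.
  have si t : Y t -> t i = false.
    move=> Yt; apply/negbTE/negP => ti.
    by apply: ((sat_neg (FVar i) Y).1 h t Yt) => _ ->.
  by rewrite !si.
- move=> i ks j; split=> Y YX.
    by move=> /sat_dep_subteams h Z ZY /sat_big_and_dep; apply: h.
  by move=> h; apply/sat_dep_subteams => Z ZY /sat_big_and_dep; apply: h.
Qed.

Lemma hilbert_sound Gamma phi : hilbert Gamma phi -> entails Gamma phi.
Proof.
elim=> {phi} [phi _ Gphi X|phi _ axphi X _|phi psi _ h _ h' X satG].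
- exact.
- exact: PID_axiom_sound.
- exact: (h X satG X) (h' X satG).
Qed.

Lemma derives_sound L Gamma phi : derives L Gamma phi -> entails Gamma phi.
Proof.
by case: L; [exact: nd_sound|exact: nd_sound|exact: hilbert_sound].
Qed.

(** * Structural properties of natural deduction *)

(* [eventually Gamma F] is a filter when [F] is a nonempty chain; this makes
   weakening and compactness along chains a single induction. *)
Definition eventually Gamma (F : set (set form)) (P : set form -> Prop) :=
  exists2 A, F A & forall Delta, Gamma `|` A `<=` Delta -> P Delta.

Lemma eventually_mono Gamma F (P Q : set form -> Prop) :
  eventually Gamma F P -> (forall Delta, P Delta -> Q Delta) ->
  eventually Gamma F Q.
Proof. by move=> [A FA h] PQ; exists A => // Delta /h/PQ. Qed.

Lemma eventually_and Gamma F (P Q : set form -> Prop) :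
  total_on F subset -> eventually Gamma F P -> eventually Gamma F Q ->
  eventually Gamma F (fun Delta => P Delta /\ Q Delta).
Proof.
move=> Ftot [A FA hA] [B FB hB].
have [AB|BA] := Ftot _ _ FA FB; [exists B|exists A] => // Delta h; split.
- by apply: hA; apply: subset_trans h; apply: setUS.
- exact: hB.
- exact: hA.
- by apply: hB; apply: subset_trans h; apply: setUS.
Qed.

Lemma eventually_all Gamma F (ks : seq nat) (P : nat -> set form -> Prop) :
  F !=set0 -> total_on F subset ->
  (forall i, i \in ks -> eventually Gamma F (P i)) ->
  eventually Gamma F (fun Delta => forall i, i \in ks -> P i Delta).
Proof.
move=> [A0 FA0] Ftot; elim: ks => [|k ks IH] h; first by exists A0.
have hk := h k (mem_head _ _).
have {}IH := IH (fun i iks => h i (mem_behead (s := k :: ks) iks)).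
apply: eventually_mono (eventually_and Ftot hk IH) _ => Delta [hk' h'] i.
by rewrite in_cons => /orP[/eqP->|/h'].
Qed.

Lemma eventuallyU Gamma F B (P : set form -> Prop) :
  eventually (B `|` Gamma) F P ->
  eventually Gamma F (fun Delta => P (B `|` Delta)).
Proof.
move=> [A FA h]; exists A => // Delta hD; apply: h.
by rewrite -setUA; apply: setUS.
Qed.

(** Discharging rules enlarge the hypotheses, so the statement allows a part [Gamma] outside the
    chain: [subU] puts the discharged formulas into it and [eventuallyU] takes them out again. The
    chain whose only member is the empty set gives weakening. *)
Lemma nd_eventually L Delta phi F : F !=set0 -> total_on F subset ->
  nd L Delta phi -> forall Gamma, Delta `<=` Gamma `|` \bigcup_(A in F) A ->
  eventually Gamma F (fun Delta' => nd L Delta' phi).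
Proof.
move=> F0 Ftot.
have subU (B D G U : set form) : D `<=` G `|` U -> B `|` D `<=` (B `|` G) `|` U.
  by move=> h; rewrite -setUA; apply: setUS.
have ev1 G (P Q : set form -> Prop) : (forall D, P D -> Q D) ->
    eventually G F P -> eventually G F Q.
  by move=> PQ h; apply: eventually_mono h PQ.
have ev2 G (P P' Q : set form -> Prop) : (forall D, P D -> P' D -> Q D) ->
    eventually G F P -> eventually G F P' -> eventually G F Q.
  move=> PQ h h'.
  by apply: eventually_mono (eventually_and Ftot h h') _ => D [? ?]; apply: PQ.
have ev3 G (P P' P'' Q : set form -> Prop) :
    (forall D, P D -> P' D -> P'' D -> Q D) -> eventually G F P ->
    eventually G F P' -> eventually G F P'' -> eventually G F Q.
  move=> PQ h h' h''; apply: ev2 h (eventually_and Ftot h' h'') => D ? [? ?].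
  exact: PQ.
have ev0 G (Q : set form -> Prop) : (forall D, Q D) -> eventually G F Q.
  by move=> hQ; case: F0 => A FA; exists A.
elim=> {Delta phi}.
- move=> D phi lphi Dphi G DG.
  have [Gphi|[A FA Aphi]] := DG _ Dphi.
    case: F0 => A FA; exists A => // D' h.
    by apply: nd_hyp => //; apply: h; left.
  by exists A => // D' h; apply: nd_hyp => //; apply: h; right.
- by move=> D i G DG; apply: ev0 => ?; apply: nd_em.
- move=> D phi psi _ h _ h' G DG.
  by apply: ev2 (h _ DG) (h' _ DG) => ?; apply: nd_andI.
- move=> D phi psi _ h G DG; apply: ev1 (h _ DG) => ?; exact: nd_andEl.
- move=> D phi psi _ h G DG; apply: ev1 (h _ DG) => ?; exact: nd_andEr.
- by move=> D phi psi ? _ h G DG; apply: ev1 (h _ DG) => ?; apply: nd_tensorIl.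
- by move=> D phi psi ? _ h G DG; apply: ev1 (h _ DG) => ?; apply: nd_tensorIr.
- move=> D phi psi alpha ca _ h _ h1 _ h2 G DG.
  apply: ev3 (h _ DG) (eventuallyU (h1 _ (subU _ _ _ _ DG)))
    (eventuallyU (h2 _ (subU _ _ _ _ DG))) => ?; exact: nd_tensorE.
- move=> D phi psi chi _ h _ h1 G DG.
  apply: ev2 (h _ DG) (eventuallyU (h1 _ (subU _ _ _ _ DG))) => ?.
  exact: nd_tensor_sub.
- move=> D phi psi _ h G DG; apply: ev1 (h _ DG) => ?; exact: nd_tensorC.
- move=> D phi psi chi _ h G DG; apply: ev1 (h _ DG) => ?; exact: nd_tensorA.
- move=> D i _ h G DG; apply: ev1 (h _ DG) => ?; exact: nd_contra.
- move=> D phi _ h G DG; apply: ev1 (h _ DG) => ?; exact: nd_botE.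
- by move=> D phi psi ? ? _ h G DG; apply: ev1 (h _ DG) => ?; apply: nd_orIl.
- by move=> D phi psi ? ? _ h G DG; apply: ev1 (h _ DG) => ?; apply: nd_orIr.
- move=> D phi psi chi ? _ h _ h1 _ h2 G DG.
  apply: ev3 (h _ DG) (eventuallyU (h1 _ (subU _ _ _ _ DG)))
    (eventuallyU (h2 _ (subU _ _ _ _ DG))) => ?; exact: nd_orE.
- by move=> D phi psi chi ? _ h G DG; apply: ev1 (h _ DG) => ?; apply: nd_distr.
- by move=> D i ? _ h G DG; apply: ev1 (h _ DG) => ?; apply: nd_dep0I1.
- by move=> D i ? _ h G DG; apply: ev1 (h _ DG) => ?; apply: nd_dep0I0.
- move=> D ks j ? _ h G DG.
  by apply: ev1 (eventuallyU (h _ (subU _ _ _ _ DG))) => ?; apply: nd_depI.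
- move=> D i theta ? _ h _ h1 _ h2 G DG.
  apply: ev3 (h _ DG) (eventuallyU (h1 _ (subU _ _ _ _ DG)))
    (eventuallyU (h2 _ (subU _ _ _ _ DG))) => ?; exact: nd_dep0E.
- move=> D ks j ? _ h _ h' G DG.
  apply: ev2 (h _ DG)
    (eventually_all F0 Ftot (fun i iks => h' i iks _ DG)) => ?.
  exact: nd_depE.
- move=> D C i theta ? _ h _ h1 _ h2 G DG.
  apply: ev3 (h _ DG) (eventuallyU (h1 _ (subU _ _ _ _ DG)))
    (eventuallyU (h2 _ (subU _ _ _ _ DG))) => ?; exact: nd_strongE.
Qed.

Lemma nd_weaken L Gamma Delta phi :
  Gamma `<=` Delta -> nd L Gamma phi -> nd L Delta phi.
Proof.
move=> GD Gphi; have F0 : [set (set0 : set form)] !=set0 by exists set0.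
have Ftot : total_on [set (set0 : set form)] subset by move=> A B -> _; left.
have [|A -> h] := nd_eventually F0 Ftot Gphi (Gamma := Gamma).
  exact: subsetUl.
by apply: h; rewrite setU0.
Qed.

Lemma nd_compact L Gamma F phi : F !=set0 -> total_on F subset ->
  nd L (Gamma `|` \bigcup_(A in F) A) phi ->
  exists2 A, F A & nd L (Gamma `|` A) phi.
Proof.
move=> F0 Ftot h; have [A FA hA] := nd_eventually F0 Ftot h (@subset_refl _ _).
by exists A; last exact: hA.
Qed.

Lemma nd_lang L Gamma phi : L <> PID -> nd L Gamma phi -> in_lang L phi.
Proof.
move=> LnPID; have Ltensor (chi psi : form) :
    in_lang L (FTensor chi psi) = in_lang L chi && in_lang L psi.
  by case: L LnPID.
have Land (chi psi : form) :
    in_lang L (FAnd chi psi) = in_lang L chi && in_lang L psi.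
  by case: L {LnPID Ltensor}.
elim=> {Gamma phi} //=.
- by move=> Gamma i; case: L LnPID {Ltensor Land}.
- by move=> Gamma phi psi _ h _ h'; rewrite Land h h'.
- by move=> Gamma phi psi _; rewrite Land => /andP[].
- by move=> Gamma phi psi _; rewrite Land => /andP[].
- by move=> Gamma phi psi h _ h'; rewrite Ltensor h h'.
- by move=> Gamma phi psi h _ h'; rewrite Ltensor h h'.
- by move=> Gamma phi psi chi _ + _ h'; rewrite !Ltensor h' => /andP[->].
- by move=> Gamma phi psi _; rewrite !Ltensor andbC.
- by move=> Gamma phi psi chi _; rewrite !Ltensor andbA.
- by move=> Gamma i _ _; case: L LnPID {Ltensor Land}.
- by move=> Gamma phi _; rewrite Ltensor => /andP[].
- by move=> Gamma phi psi -> /= -> _ ->.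
- by move=> Gamma phi psi -> /= -> _ ->.
- by move=> Gamma phi psi chi LE _; rewrite LE /= => /and3P[-> -> ->].
- by move=> Gamma i ->.
- by move=> Gamma i ->.
- by move=> Gamma ks j ->.
- by move=> Gamma ks j ->.
Qed.

(** A hypothesis outside the language can never be cited, so only those within it need derivations.
    The induction runs over all [Delta] because discharging rules enlarge both sides by the same
    formulas. *)
Lemma nd_subst L Gamma Delta phi : nd L Gamma phi ->
  (forall psi, in_lang L psi -> Gamma psi -> nd L Delta psi) -> nd L Delta phi.
Proof.
pose sub G D := forall psi, in_lang L psi -> G psi -> nd L D psi.
have subU B G D : sub G D -> sub (B `|` G) (B `|` D).
  move=> h psi lpsi [?|Gpsi]; first by apply: nd_hyp => //; left.
  exact: nd_weaken (@subsetUr _ _ _) (h _ lpsi Gpsi).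
move=> Gphi; rewrite -/(sub Gamma Delta); elim: Gphi Delta => {Gamma phi}.
- by move=> G phi lphi Gphi D /(_ _ lphi); apply.
- by move=> *; apply: nd_em.
- by move=> G phi psi _ h _ h' D GD; apply: nd_andI; [apply: h|apply: h'].
- move=> G phi psi _ h D /h; exact: nd_andEl.
- move=> G phi psi _ h D /h; exact: nd_andEr.
- by move=> G phi psi ? _ h D /h; apply: nd_tensorIl.
- by move=> G phi psi ? _ h D /h; apply: nd_tensorIr.
- move=> G phi psi alpha ? _ h _ h1 _ h2 D GD.
  by apply: nd_tensorE (h _ GD) (h1 _ (subU _ _ _ GD)) (h2 _ (subU _ _ _ GD)).
- move=> G phi psi chi _ h _ h1 D GD.
  exact: nd_tensor_sub (h _ GD) (h1 _ (subU _ _ _ GD)).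
- move=> G phi psi _ h D /h; exact: nd_tensorC.
- move=> G phi psi chi _ h D /h; exact: nd_tensorA.
- move=> G i _ h D /h; exact: nd_contra.
- move=> G phi _ h D /h; exact: nd_botE.
- by move=> G phi psi ? ? _ h D /h; apply: nd_orIl.
- by move=> G phi psi ? ? _ h D /h; apply: nd_orIr.
- move=> G phi psi chi ? _ h _ h1 _ h2 D GD.
  by apply: nd_orE (h _ GD) (h1 _ (subU _ _ _ GD)) (h2 _ (subU _ _ _ GD)).
- by move=> G phi psi chi ? _ h D /h; apply: nd_distr.
- by move=> G i ? _ h D /h; apply: nd_dep0I1.
- by move=> G i ? _ h D /h; apply: nd_dep0I0.
- by move=> G ks j ? _ h D GD; apply: nd_depI (h _ (subU _ _ _ GD)).
- move=> G i theta ? _ h _ h1 _ h2 D GD.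
  by apply: nd_dep0E (h _ GD) (h1 _ (subU _ _ _ GD)) (h2 _ (subU _ _ _ GD)).
- move=> G ks j ? _ h _ h' D GD.
  by apply: nd_depE (h _ GD) _ => // i iks; apply: h'.
- move=> G C i theta ? _ h _ h1 _ h2 D GD.
  by apply: nd_strongE (h _ GD) (h1 _ (subU _ _ _ GD)) (h2 _ (subU _ _ _ GD)).
Qed.

Lemma nd_cut L Gamma phi psi :
  nd L Gamma phi -> nd L (phi |` Gamma) psi -> nd L Gamma psi.
Proof.
move=> hphi hpsi; apply: nd_subst hpsi _ => chi lchi [->//|Gchi].
exact: nd_hyp.
Qed.

Lemma nd_weaken1 L Gamma phi psi : nd L Gamma psi -> nd L (phi |` Gamma) psi.
Proof. by apply: nd_weaken; apply: subsetUr. Qed.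

Lemma nd_hyp1 L Gamma phi : in_lang L phi -> nd L (phi |` Gamma) phi.
Proof. by move=> lphi; apply: nd_hyp => //; left. Qed.

(** * Resolutions *)

Definition neg_var L i := if L is PID then fneg (FVar i) else FNegVar i.

(** Either form says that [phi] holds on the part of the team where p_i is true and [psi] on the
    part where it is false. PID has no tensor, so there two implications take its place. *)
Definition dep_case L i phi psi :=
  if L is PID
  then FAnd (FImp (FVar i) phi) (FImp (fneg (FVar i)) psi)
  else FTensor (FAnd (FVar i) phi) (FAnd (FNegVar i) psi).

(** The members are decision trees over [ks] with p_j or its negation at the leaves; each describes
    a Boolean function through which the values of [ks] may determine p_j. *)
Fixpoint dep_res L (ks : seq nat) j : seq form :=
  if ks is i :: ks'
  then [seq dep_case L i a b | a <- dep_res L ks' j, b <- dep_res L ks' j]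
  else [:: FVar j; neg_var L j].

(* One conjunction of implications [a -> f a] for each choice function [f]
   from [A] to [B]. *)
Fixpoint imp_res (A B : seq form) : seq form :=
  if A is a :: A'
  then [seq FAnd (FImp a b) c | b <- B, c <- imp_res A' B]
  else [:: FImp FBot FBot].

Fixpoint res L phi : seq form :=
  match phi with
  | FVar _ | FNegVar _ | FBot => [:: phi]
  | FDep ks j => dep_res L ks j
  | FAnd phi psi => [seq FAnd a b | a <- res L phi, b <- res L psi]
  | FTensor phi psi => [seq FTensor a b | a <- res L phi, b <- res L psi]
  | FOr phi psi => res L phi ++ res L psi
  | FImp phi psi => imp_res (res L phi) (res L psi)
  end.

(** The split axiom and [big_or] speak of nonempty disjunctions only. *)
Lemma res_size_gt0 L phi : 0 < size (res L phi).
Proof.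
elim: phi => //= [ks j|phi h psi h'|phi h psi h'|phi h psi h'|phi _ psi h].
- by elim: ks => //= i ks IH; rewrite size_allpairs muln_gt0 IH.
- by rewrite size_allpairs muln_gt0 h.
- by rewrite size_allpairs muln_gt0 h.
- by rewrite size_cat addn_gt0 h.
- by elim: (res L phi) => //= a A IH; rewrite size_allpairs muln_gt0 h.
Qed.

Lemma res_flat L phi alpha : in_lang L phi -> alpha \in res L phi ->
  in_lang L alpha && flat alpha.
Proof.
elim: phi alpha => [i|i||ks j|phi IHphi psi IHpsi|phi IHphi psi IHpsi
  |phi IHphi psi IHpsi|phi IHphi psi IHpsi] alpha lphi /=.
- by rewrite mem_seq1 => /eqP->; rewrite lphi.
- by rewrite mem_seq1 => /eqP->; rewrite lphi.
- by rewrite mem_seq1 => /eqP->; rewrite lphi.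
- have {lphi} LnPDv : L <> PDv by move=> LE; rewrite LE in lphi.
  elim: ks alpha => [|i ks IH] alpha /=.
    by rewrite !inE => /orP[]/eqP->; case: (L) LnPDv.
  move=> /allpairsP[[a b] /= [/IH/andP[la fa] /IH/andP[lb fb] ->]].
  by case: (L) LnPDv la lb => //= _ -> ->; rewrite fa fb.
- have /andP[{}/IHphi IHphi {}/IHpsi IHpsi] : in_lang L phi && in_lang L psi.
    by case: (L) lphi.
  move=> /allpairsP[[a b] /= [/IHphi/andP[la fa] /IHpsi/andP[lb fb] ->]].
  by case: (L) la lb => /= -> ->; rewrite fa fb.
- have /andP[{}/IHphi IHphi {}/IHpsi IHpsi] : in_lang L phi && in_lang L psi.
    by case: (L) lphi.
  move=> /allpairsP[[a b] /= [/IHphi/andP[la fa] /IHpsi/andP[lb fb] ->]].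
  by case: (L) lphi la lb => //= _ -> ->; rewrite fa fb.
- have /andP[{}/IHphi IHphi {}/IHpsi IHpsi] : in_lang L phi && in_lang L psi.
    by case: (L) lphi.
  by rewrite mem_cat => /orP[/IHphi|/IHpsi].
- have LE : L = PID by case: (L) lphi.
  move: lphi IHphi IHpsi; rewrite LE /= => /andP[lphi lpsi] + /(_ _ lpsi) IHpsi.
  move=> /(_ _ lphi); elim: (res PID phi) alpha => [|a A IH] alpha hA /=.
    by rewrite mem_seq1 => /eqP->.
  move=> /allpairsP[[b c] /= [/IHpsi/andP[lb fb] cin ->]] /=.
  have /andP[la fa] := hA a (mem_head _ _).
  have /IH/(_ cin)/andP[lc fc] : forall x, x \in A -> in_PID x && flat x.
    by move=> x xA; apply: hA; rewrite in_cons xA orbT.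
  by rewrite la lb lc fa fb fc.
Qed.

(** * Resolutions in the natural deduction systems *)

Lemma nd_exfalso L Gamma phi :
  in_lang L phi -> nd L Gamma FBot -> nd L Gamma phi.
Proof. by move=> lphi h; apply: nd_botE; apply: nd_tensorIr. Qed.

Lemma nd_tensor_mono L Gamma phi psi phi' psi' :
  nd L Gamma (FTensor phi psi) -> nd L (phi |` Gamma) phi' ->
  nd L (psi |` Gamma) psi' -> nd L Gamma (FTensor phi' psi').
Proof.
move=> h h1 h2; apply: nd_tensorC; apply: nd_tensor_sub h1.
by apply: nd_tensorC; apply: nd_tensor_sub h2.
Qed.

(** In either half of excluded middle for p_i the variable p_i is constant, so it may be dropped
    from the arguments of the dependence atom. *)
Lemma nd_dep_case L Gamma i ks j : L = PD ->
  nd L Gamma (FDep (i :: ks) j) ->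
  nd L Gamma (dep_case PD i (FDep ks j) (FDep ks j)).
Proof.
move=> -> h.
have D chi : nd PD (chi |` Gamma) (FDep [::] i) ->
    nd PD (chi |` Gamma) (FDep ks j).
  move=> hi; apply: nd_depI => //; apply: (@nd_depE _ _ (i :: ks)) => //.
    by apply: nd_weaken h => psi ?; right; right.
  move=> k; rewrite in_cons => /orP[/eqP->|kks].
    by apply: nd_weaken hi; apply: subsetUr.
  by apply: nd_hyp => //; left; exists k.
apply: nd_tensor_mono (nd_em _ _ i) _ _; apply: nd_andI.
- exact: nd_hyp1.
- by apply: D; apply: nd_dep0I1 => //; apply: nd_hyp1.
- exact: nd_hyp1.
- by apply: D; apply: nd_dep0I0 => //; apply: nd_hyp1.
Qed.

Lemma nd_dep_caseE L Gamma i ks j : L = PD ->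
  nd L Gamma (dep_case PD i (FDep ks j) (FDep ks j)) ->
  nd L Gamma (FDep (i :: ks) j).
Proof.
move=> -> h; apply: nd_depI => //; set Gamma' := _ `|` Gamma.
have {}h : nd PD Gamma' (dep_case PD i (FDep ks j) (FDep ks j)).
  by apply: nd_weaken h; apply: subsetUr.
have hk k : k \in i :: ks -> nd PD Gamma' (FDep [::] k).
  by move=> kin; apply: nd_hyp => //; left; exists k.
have E chi : nd PD (chi |` Gamma') (FDep ks j) ->
    nd PD (chi |` Gamma') (FDep [::] j).
  move=> hD; apply: nd_depE hD _ => // k kks; apply: nd_weaken1.
  by apply: hk; rewrite in_cons kks orbT.
apply: (nd_dep0E (i := i)) => //; first by apply: hk; rewrite mem_head.
(* Under p_i the half of the tensor containing its negation collapses to [FBot] and is discarded.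
   The other case is the mirror image. *)
- apply: E; apply: nd_botE; apply: nd_tensor_mono (nd_weaken1 _ h) _ _.
    by apply: nd_andEr (nd_hyp1 _ _).
  apply: (nd_contra (i := i)); apply: nd_andI.
    by apply: nd_weaken1; apply: nd_hyp1.
  by apply: nd_andEl (nd_hyp1 _ _).
- apply: E; apply: nd_botE; apply: nd_tensorC.
  apply: nd_tensor_mono (nd_weaken1 _ h) _ _; last first.
    by apply: nd_andEr (nd_hyp1 _ _).
  apply: (nd_contra (i := i)); apply: nd_andI.
    by apply: nd_andEl (nd_hyp1 _ _).
  by apply: nd_weaken1; apply: nd_hyp1.
Qed.

Lemma nd_res_intro L Gamma phi alpha : L <> PID -> in_lang L phi ->
  alpha \in res L phi -> nd L Gamma alpha -> nd L Gamma phi.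
Proof.
move=> LnPID; elim: phi alpha Gamma => [i|i||ks j|phi IHphi psi IHpsi
  |phi IHphi psi IHpsi|phi IHphi psi IHpsi|phi _ psi _] alpha Gamma lphi /=.
- by rewrite mem_seq1 => /eqP->.
- by rewrite mem_seq1 => /eqP->.
- by rewrite mem_seq1 => /eqP->.
- have LE : L = PD by case: (L) LnPID lphi.
  rewrite LE; elim: ks alpha Gamma {lphi} => [|i ks IH] alpha Gamma /=.
    by rewrite !inE => /orP[]/eqP-> ?; [apply: nd_dep0I1|apply: nd_dep0I0].
  move=> /allpairsP[[a b] /= [ain bin ->]] h; apply: nd_dep_caseE => //.
  have /= /andP[la lb] := nd_lang (L := PD) ltac:(by []) h.
  apply: nd_tensor_mono h _ _; apply: nd_andI.
  + by apply: nd_andEl (nd_hyp1 _ _).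
  + by apply: IH ain _; apply: nd_andEr (nd_hyp1 _ _).
  + by apply: nd_andEl (nd_hyp1 _ _).
  + by apply: IH bin _; apply: nd_andEr (nd_hyp1 _ _).
- have /andP[lphi' lpsi] : in_lang L phi && in_lang L psi by case: (L) lphi.
  move=> /allpairsP[[a b] /= [ain bin ->]] h; apply: nd_andI.
    exact: IHphi ain (nd_andEl h).
  exact: IHpsi bin (nd_andEr h).
- have /andP[lphi' lpsi] : in_lang L phi && in_lang L psi by case: (L) lphi.
  move=> /allpairsP[[a b] /= [ain bin ->]] h.
  have /andP[la _] := res_flat lphi' ain.
  have /andP[lb _] := res_flat lpsi bin.
  apply: nd_tensor_mono h _ _.
    by apply: IHphi ain (nd_hyp1 _ _).
  by apply: IHpsi bin (nd_hyp1 _ _).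
- have LE : L = PDv by case: (L) LnPID lphi.
  have /andP[lphi' lpsi] : in_lang L phi && in_lang L psi by case: (L) lphi.
  rewrite mem_cat => /orP[ain|ain] h.
    by apply: nd_orIl => //; apply: IHphi ain h.
  by apply: nd_orIr => //; apply: IHpsi ain h.
- by case: (L) LnPID lphi.
Qed.

Fixpoint ctx_comp (C C' : ctx) : ctx :=
  match C with
  | CHole => C'
  | CAndl C psi => CAndl (ctx_comp C C') psi
  | CAndr psi C => CAndr psi (ctx_comp C C')
  | CTensorl C psi => CTensorl (ctx_comp C C') psi
  | CTensorr psi C => CTensorr psi (ctx_comp C C')
  end.

Lemma fill_comp C C' phi : fill (ctx_comp C C') phi = fill C (fill C' phi).
Proof. by elim: C => //= [C ->|psi C ->|C ->|psi C ->]. Qed.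

Lemma in_lang_tensor L phi psi : L <> PID ->
  in_lang L (FTensor phi psi) = in_lang L phi && in_lang L psi.
Proof. by case: L. Qed.

Lemma nd_fill_mono L Gamma C phi psi : L <> PID ->
  nd L Gamma (fill C phi) -> nd L (phi |` Gamma) psi ->
  nd L Gamma (fill C psi).
Proof.
move=> LnPID h hpsi; have {}hpsi Delta : Gamma `<=` Delta ->
    nd L (phi |` Delta) psi.
  by move=> GD; apply: nd_weaken hpsi; apply: setUS.
elim: C Gamma h hpsi => [|C IH chi|chi C IH|C IH chi|chi C IH] Gamma /= h hpsi.
- exact: nd_cut h (hpsi _ (@subset_refl _ _)).
- exact: nd_andI (IH _ (nd_andEl h) hpsi) (nd_andEr h).
- exact: nd_andI (nd_andEl h) (IH _ (nd_andEr h) hpsi).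
- have := nd_lang LnPID h; rewrite in_lang_tensor // => /andP[lC _].
  apply: nd_tensorC; apply: nd_tensor_sub (nd_tensorC h) _.
  apply: IH (nd_hyp1 _ lC) _ => Delta GD; apply: hpsi.
  by apply: subset_trans GD; apply: subsetUr.
- have := nd_lang LnPID h; rewrite in_lang_tensor // => /andP[_ lC].
  apply: nd_tensor_sub h _; apply: IH (nd_hyp1 _ lC) _ => Delta GD; apply: hpsi.
  by apply: subset_trans GD; apply: subsetUr.
Qed.

(** The PDv substitute for strong elimination: distributivity carries the disjunction outwards
    through every tensor to the root, where ordinary case analysis applies. *)
Lemma nd_fill_or L Gamma C phi psi : L = PDv ->
  nd L Gamma (fill C (FOr phi psi)) ->
  nd L Gamma (FOr (fill C phi) (fill C psi)).
Proof.
move=> ->.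
elim: C Gamma => [|C IH chi|chi C IH|C IH chi|chi C IH] Gamma //= h.
- have h1 := IH _ (nd_andEl h); have h2 := nd_andEr h.
  have /= /andP[la lb] := nd_lang (L := PDv) ltac:(by []) h1.
  have /= lc := nd_lang (L := PDv) ltac:(by []) h2.
  apply: nd_orE (h1) _ _ => //; [apply: nd_orIl|apply: nd_orIr] => //=.
  + by rewrite lb lc.
  + by apply: nd_andI; [apply: nd_hyp1|apply: nd_weaken1].
  + by rewrite la lc.
  + by apply: nd_andI; [apply: nd_hyp1|apply: nd_weaken1].
- have h1 := IH _ (nd_andEr h); have h2 := nd_andEl h.
  have /= /andP[la lb] := nd_lang (L := PDv) ltac:(by []) h1.
  have /= lc := nd_lang (L := PDv) ltac:(by []) h2.
  apply: nd_orE (h1) _ _ => //; [apply: nd_orIl|apply: nd_orIr] => //=.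
  + by rewrite lb lc.
  + by apply: nd_andI; [apply: nd_weaken1|apply: nd_hyp1].
  + by rewrite la lc.
  + by apply: nd_andI; [apply: nd_weaken1|apply: nd_hyp1].
- have /= /andP[lC lc] := nd_lang (L := PDv) ltac:(by []) h.
  have h1 := nd_distr erefl
    (nd_tensor_sub (nd_tensorC h) (IH _ (nd_hyp1 (L := PDv) _ lC))).
  have /= /andP[la lb] := nd_lang (L := PDv) ltac:(by []) h1.
  apply: nd_orE (h1) _ _ => //.
    by apply: nd_orIl; [|rewrite /= andbC|apply: nd_tensorC; apply: nd_hyp1].
  by apply: nd_orIr; [|rewrite /= andbC|apply: nd_tensorC; apply: nd_hyp1].
- have /= /andP[lc lC] := nd_lang (L := PDv) ltac:(by []) h.
  exact: nd_distr erefl (nd_tensor_sub h (IH _ (nd_hyp1 (L := PDv) _ lC))).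
Qed.

Lemma in_lang_fill L C phi : L <> PID ->
  in_lang L (fill C phi) = in_lang L (fill C FBot) && in_lang L phi.
Proof.
case: L => // _; elim: C => //= [C -> psi|psi C ->|C -> psi|psi C ->];
  by rewrite ?andbA // andbAC.
Qed.

(* Strong elimination in PD and distributivity in PDv let case distinctions be
   made underneath a tensor, hence the statement with a context. *)
Lemma nd_res_elim_fill L Gamma C phi theta : L <> PID ->
  nd L Gamma (fill C phi) ->
  (forall alpha, alpha \in res L phi ->
     nd L (fill C alpha |` Gamma) theta) ->
  nd L Gamma theta.
Proof.
move=> LnPID.
have lang_fill Delta D chi : nd L Delta (fill D chi) ->
    in_lang L (fill D FBot) /\ in_lang L chi.
  by move/(nd_lang LnPID); rewrite in_lang_fill // => /andP.
elim: phi C Gamma => [i|i||ks j|phi IHphi psi IHpsi|phi IHphi psi IHpsi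
  |phi IHphi psi IHpsi|phi _ psi _] C Gamma h;
  have [lC lphi] := lang_fill _ _ _ h; rewrite /=.
- by move=> /(_ _ (mem_head _ _)); apply: nd_cut.
- by move=> /(_ _ (mem_head _ _)); apply: nd_cut.
- by move=> /(_ _ (mem_head _ _)); apply: nd_cut.
- have LE : L = PD by case: (L) LnPID lphi.
  rewrite LE in h lC *.
  elim: ks C Gamma h lC {lphi} => [|i ks IH] C Gamma h lC hres.
    apply: nd_strongE h _ _ => //; apply: hres; rewrite !inE eqxx //.
    by rewrite orbT.
  set D := FDep ks j.
  have lfill chi : in_lang PD chi -> in_lang PD (fill C chi).
    by rewrite in_lang_fill // lC.
  have {}h : nd PD Gamma (fill C (dep_case PD i D D)).
    apply: nd_fill_mono h _ => //; apply: nd_dep_case => //; exact: nd_hyp1.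
  (* The two occurrences of [D] are resolved in turn, with the hole first in the left half of the
     expansion and then in the right, so that [a] and [b] vary independently. *)
  apply: (IH (ctx_comp C
    (CTensorl (CAndr (FVar i) CHole) (FAnd (FNegVar i) D)))).
  + by rewrite fill_comp.
  + by rewrite fill_comp; apply: lfill.
  move=> a ain; rewrite fill_comp /=.
  have /andP[/= la _] := @res_flat PD (FDep ks j) a isT ain.
  apply: (IH (ctx_comp C
    (CTensorr (FAnd (FVar i) a) (CAndr (FNegVar i) CHole)))).
  + by rewrite fill_comp /=; apply: nd_hyp1; apply: lfill; rewrite /= la.
  + by rewrite fill_comp; apply: lfill; rewrite /= la.
  move=> b bin; rewrite fill_comp /=.
  apply: nd_weaken (hres (dep_case PD i a b) _).
    by apply: setUS; apply: subsetUr.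
  exact: allpairs_f.
- have /andP[lphi' lpsi] : in_lang L phi && in_lang L psi by case: (L) lphi.
  have lAnd x y : in_lang L x -> in_lang L y -> in_lang L (FAnd x y).
    by case: (L) => /= -> ->.
  move=> hres; apply: (IHphi (ctx_comp C (CAndl CHole psi))).
    by rewrite fill_comp.
  move=> a ain; rewrite fill_comp /=; have /andP[la _] := res_flat lphi' ain.
  apply: (IHpsi (ctx_comp C (CAndr a CHole))).
    by rewrite fill_comp /=; apply: nd_hyp1; rewrite in_lang_fill // lC lAnd.
  move=> b bin; rewrite fill_comp /=; apply: nd_weaken (hres (FAnd a b) _).
    by apply: setUS; apply: subsetUr.
  exact: allpairs_f.
- move: lphi; rewrite in_lang_tensor // => /andP[lphi lpsi].
  move=> hres; apply: (IHphi (ctx_comp C (CTensorl CHole psi))).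
    by rewrite fill_comp.
  move=> a ain; rewrite fill_comp /=; have /andP[la _] := res_flat lphi ain.
  apply: (IHpsi (ctx_comp C (CTensorr a CHole))).
    rewrite fill_comp /=; apply: nd_hyp1.
    by rewrite in_lang_fill // lC in_lang_tensor // la.
  move=> b bin; rewrite fill_comp /=; apply: nd_weaken (hres (FTensor a b) _).
    by apply: setUS; apply: subsetUr.
  exact: allpairs_f.
- have LE : L = PDv by case: (L) LnPID lphi.
  have /andP[lphi' lpsi] : in_lang L phi && in_lang L psi by case: (L) lphi.
  move=> hres; apply: nd_orE (nd_fill_or LE h) _ _ => //.
    apply: IHphi (nd_hyp1 _ _) _; first by rewrite in_lang_fill // lC.
    move=> a ain; apply: nd_weaken (hres a _); last by rewrite mem_cat ain.
    by apply: setUS; apply: subsetUr.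
  apply: IHpsi (nd_hyp1 _ _) _; first by rewrite in_lang_fill // lC.
  move=> a ain; apply: nd_weaken (hres a _); last by rewrite mem_cat ain orbT.
  by apply: setUS; apply: subsetUr.
- by case: (L) LnPID lphi.
Qed.

Lemma nd_res_elim L Gamma phi theta : L <> PID -> nd L Gamma phi ->
  (forall alpha, alpha \in res L phi -> nd L (alpha |` Gamma) theta) ->
  nd L Gamma theta.
Proof. by move=> LnPID; apply: (@nd_res_elim_fill L Gamma CHole). Qed.

(** In PD the disjunction of the resolutions is not a formula of the language, so the claim is
    checked directly on teams and not drawn from soundness. *)
Lemma sat_res L phi X : L <> PID -> in_lang L phi -> sat X phi ->
  exists2 alpha, alpha \in res L phi & sat X alpha.
Proof.
move=> LnPID; elim: phi X => [i|i||ks j|phi IHphi psi IHpsi|phi IHphi psi IHpsi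
  |phi IHphi psi IHpsi|phi _ psi _] X lphi.
- by move=> ?; exists (FVar i); rewrite /= ?mem_seq1.
- by move=> ?; exists (FNegVar i); rewrite /= ?mem_seq1.
- by move=> ?; exists FBot; rewrite /= ?mem_seq1.
- have -> : L = PD by case: (L) LnPID lphi.
  elim: ks X {lphi} => [|i ks IH] X h.
    case: (@sat_fill_dep0 CHole _ _ h) => ?;
      [exists (FVar j)|exists (FNegVar j)];
      by rewrite //= !inE eqxx ?orbT.
  (* On the part of the team where p_i has the fixed value [b], agreement on [ks] already gives
     agreement on [i :: ks]. *)
  have D b : sat (X `&` [set s | s i = b]) (FDep ks j).
    move=> s s' [Xs sb] [Xs' s'b] ss'; apply: h => // k.
    by rewrite in_cons => /orP[/eqP->|/ss'//]; rewrite sb s'b.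
  have [a ain sata] := IH _ (D true); have [b bin satb] := IH _ (D false).
  exists (dep_case PD i a b); first exact: allpairs_f.
  exists (X `&` [set s | s i = true]), (X `&` [set s | s i = false]); split.
  + exact: subIsetl.
  + exact: subIsetl.
  + rewrite -setIUr setIidl // => s _; by case si: (s i); [left|right].
  + by split=> // s [].
  + by split=> // s [].
- have /andP[lphi' lpsi] : in_lang L phi && in_lang L psi by case: (L) lphi.
  move=> [/(IHphi _ lphi')[a ? ?] /(IHpsi _ lpsi)[b ? ?]].
  by exists (FAnd a b) => //; apply: allpairs_f.
- move: lphi; rewrite in_lang_tensor // => /andP[lphi lpsi].
  move=> [Y [Z [? ? ? /(IHphi _ lphi)[a ? ?] /(IHpsi _ lpsi)[b ? ?]]]].
  by exists (FTensor a b); [apply: allpairs_f|exists Y, Z].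
- have /andP[lphi' lpsi] : in_lang L phi && in_lang L psi by case: (L) lphi.
  by case=> [/(IHphi _ lphi')[a ? ?]|/(IHpsi _ lpsi)[a ain ?]]; exists a;
    rewrite //= mem_cat; apply/orP; [left|right].
- by case: (L) LnPID lphi.
Qed.

(** * Derived rules of the Hilbert system *)

Lemma hilbert_lang Gamma phi : hilbert Gamma phi -> in_PID phi.
Proof. by elim=> //= ? ? _ /andP[]. Qed.

Lemma hilbert_subst Gamma Delta phi : hilbert Gamma phi ->
  (forall psi, in_PID psi -> Gamma psi -> hilbert Delta psi) ->
  hilbert Delta phi.
Proof.
elim=> {phi} [phi lphi Gphi|phi lphi axphi|phi psi _ h _ h'] GD.
- exact: GD.
- exact: hilbert_ax.
- exact: hilbert_mp (h GD) (h' GD).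
Qed.

Lemma hilbert_weaken Gamma Delta phi :
  Gamma `<=` Delta -> hilbert Gamma phi -> hilbert Delta phi.
Proof.
move=> GD h; apply: hilbert_subst h _ => psi lpsi /GD; exact: hilbert_hyp.
Qed.

Lemma hilbert_weaken1 Gamma phi psi :
  hilbert Gamma psi -> hilbert (phi |` Gamma) psi.
Proof. by apply: hilbert_weaken; apply: subsetUr. Qed.

Lemma hilbert_hyp1 Gamma phi : in_PID phi -> hilbert (phi |` Gamma) phi.
Proof. by move=> lphi; apply: hilbert_hyp => //; left. Qed.

Lemma hilbert_cut Gamma phi psi :
  hilbert Gamma phi -> hilbert (phi |` Gamma) psi -> hilbert Gamma psi.
Proof.
move=> hphi hpsi; apply: hilbert_subst hpsi _ => chi lchi [->//|].
exact: hilbert_hyp.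
Qed.

(** Modus ponens discharges nothing, so the hypotheses stay fixed and a direct induction
    suffices. *)
Lemma hilbert_compact Gamma F phi : F !=set0 -> total_on F subset ->
  hilbert (Gamma `|` \bigcup_(A in F) A) phi ->
  exists2 A, F A & hilbert (Gamma `|` A) phi.
Proof.
move=> [A0 FA0] Ftot.
elim=> {phi} [phi lphi [Gphi|[A FA Aphi]]|phi lphi axphi|phi psi].
- by exists A0 => //; apply: hilbert_hyp => //; left.
- by exists A => //; apply: hilbert_hyp => //; right.
- by exists A0 => //; apply: hilbert_ax.
- move=> _ [A FA hA] _ [B FB hB].
  have [AB|BA] := Ftot _ _ FA FB; [exists B|exists A] => //.
    by apply: hilbert_mp (hB); apply: hilbert_weaken hA; apply: setUS.
  by apply: hilbert_mp (hA) _; apply: hilbert_weaken hB; apply: setUS.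
Qed.

Lemma hilbert_int Gamma phi : in_PID phi -> int_axiom phi -> hilbert Gamma phi.
Proof. by move=> lphi axphi; apply: hilbert_ax => //; apply: PID_int. Qed.

Lemma hilbert_id Gamma phi : in_PID phi -> hilbert Gamma (FImp phi phi).
Proof.
move=> lphi; apply: (hilbert_mp (phi := FImp phi (FImp phi phi))).
  apply: (hilbert_mp (phi := FImp phi (FImp (FImp phi phi) phi))).
    by apply: hilbert_int (int_S _ _ _); rewrite /= lphi.
  by apply: hilbert_int (int_K _ _); rewrite /= lphi.
by apply: hilbert_int (int_K _ _); rewrite /= lphi.
Qed.

Lemma hilbert_impI Gamma phi psi : in_PID phi ->
  hilbert (phi |` Gamma) psi -> hilbert Gamma (FImp phi psi).
Proof.
move=> lphi; have K chi : hilbert Gamma chi -> hilbert Gamma (FImp phi chi).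
  move=> h; apply: hilbert_mp (h); apply: hilbert_int (int_K _ _).
  by rewrite /= lphi (hilbert_lang h).
elim=> {psi} [psi lpsi [->|Gpsi]|psi lpsi axpsi|chi psi h IH h' IH'].
- exact: hilbert_id.
- by apply: K; apply: hilbert_hyp.
- by apply: K; apply: hilbert_ax.
- apply: hilbert_mp IH'; apply: hilbert_mp IH.
  apply: hilbert_int (int_S _ _ _).
  by have /= /andP[lchi lpsi] := hilbert_lang h; rewrite /= lphi lchi lpsi.
Qed.

Lemma hilbert_andI Gamma phi psi :
  hilbert Gamma phi -> hilbert Gamma psi -> hilbert Gamma (FAnd phi psi).
Proof.
move=> h h'; apply: hilbert_mp (h'); apply: hilbert_mp (h).
apply: hilbert_int (int_andI _ _).
by rewrite /= (hilbert_lang h) (hilbert_lang h').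
Qed.

Lemma hilbert_andEl Gamma phi psi :
  hilbert Gamma (FAnd phi psi) -> hilbert Gamma phi.
Proof.
move=> h; apply: hilbert_mp (h); apply: hilbert_int (int_andEl _ _).
by have /= /andP[lphi lpsi] := hilbert_lang h; rewrite /= lphi lpsi.
Qed.

Lemma hilbert_andEr Gamma phi psi :
  hilbert Gamma (FAnd phi psi) -> hilbert Gamma psi.
Proof.
move=> h; apply: hilbert_mp (h); apply: hilbert_int (int_andEr _ _).
by have /= /andP[lphi lpsi] := hilbert_lang h; rewrite /= lphi lpsi.
Qed.

Lemma hilbert_orIl Gamma phi psi :
  in_PID psi -> hilbert Gamma phi -> hilbert Gamma (FOr phi psi).
Proof.
move=> lpsi h; apply: hilbert_mp (h); apply: hilbert_int (int_orIl _ _).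
by rewrite /= lpsi (hilbert_lang h).
Qed.

Lemma hilbert_orIr Gamma phi psi :
  in_PID phi -> hilbert Gamma psi -> hilbert Gamma (FOr phi psi).
Proof.
move=> lphi h; apply: hilbert_mp (h); apply: hilbert_int (int_orIr _ _).
by rewrite /= lphi (hilbert_lang h).
Qed.

Lemma hilbert_orE Gamma phi psi chi : hilbert Gamma (FOr phi psi) ->
  hilbert (phi |` Gamma) chi -> hilbert (psi |` Gamma) chi ->
  hilbert Gamma chi.
Proof.
move=> h h1 h2; have /= /andP[lphi lpsi] := hilbert_lang h.
apply: hilbert_mp (h); apply: hilbert_mp (hilbert_impI lpsi h2).
apply: hilbert_mp (hilbert_impI lphi h1).
by apply: hilbert_int (int_orE _ _ _); rewrite /= lphi lpsi (hilbert_lang h1).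
Qed.

Lemma hilbert_botE Gamma phi :
  in_PID phi -> hilbert Gamma FBot -> hilbert Gamma phi.
Proof.
by move=> lphi h; apply: hilbert_mp h; apply: hilbert_int (int_botE _).
Qed.

Lemma hilbert_big_orI Gamma chi chis psi :
  all in_PID (chi :: chis) -> psi \in chi :: chis -> hilbert Gamma psi ->
  hilbert Gamma (big_or chi chis).
Proof.
elim: chis chi => [|chi' chis IH] chi; first by rewrite mem_seq1 => _ /eqP->.
move=> /= /andP[lchi lchis]; have lor : in_PID (big_or chi' chis).
  elim: (chis) (chi') lchis {IH} => [|x s IH] y /= /andP[-> //].
  exact: IH.
rewrite in_cons => /orP[/eqP-> h|pin h]; first exact: hilbert_orIl.
by apply: hilbert_orIr => //; apply: IH h.
Qed.

Lemma hilbert_big_orE Gamma chi chis theta :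
  hilbert Gamma (big_or chi chis) ->
  (forall psi, psi \in chi :: chis -> hilbert (psi |` Gamma) theta) ->
  hilbert Gamma theta.
Proof.
elim: chis chi Gamma => [|chi' chis IH] chi Gamma /= h hres.
  by apply: hilbert_cut h _; apply: hres; rewrite mem_seq1.
have /= /andP[_ lor] := hilbert_lang h.
apply: hilbert_orE h _ _; first by apply: hres; rewrite mem_head.
apply: IH (hilbert_hyp1 _ lor) _ => psi pin.
apply: hilbert_weaken (hres psi _); last by rewrite in_cons pin orbT.
by apply: setUS; apply: subsetUr.
Qed.

Lemma hilbert_big_and_dep Gamma i ks :
  hilbert Gamma (big_and (FDep [::] i) [seq FDep [::] x | x <- ks]) <->
  forall k, k \in i :: ks -> hilbert Gamma (FDep [::] k).
Proof.
elim: ks i => [|k ks IH] i.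
  by split=> [h k|]; [rewrite mem_seq1 => /eqP->|apply; rewrite mem_head].
split=> [/= h k'|h /=].
  rewrite in_cons => /orP[/eqP->|]; first exact: hilbert_andEl h.
  exact: (IH k).1 (hilbert_andEr h) k'.
apply: hilbert_andI; first by apply: h; rewrite mem_head.
by apply/IH => k' hk'; apply: h; rewrite in_cons hk' orbT.
Qed.

Lemma in_PID_big_and_dep i ks :
  in_PID (big_and (FDep [::] i) [seq FDep [::] x | x <- ks]).
Proof. by elim: ks i => //= k ks IH i. Qed.

Lemma hilbert_dep0I Gamma i :
  hilbert Gamma (FVar i) \/ hilbert Gamma (fneg (FVar i)) ->
  hilbert Gamma (FDep [::] i).
Proof.
move=> h; apply: (hilbert_mp (phi := FOr (FVar i) (fneg (FVar i)))).
  by apply: hilbert_andEr; apply: hilbert_ax (PID_dep0 i).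
by case: h => h; [apply: hilbert_orIl|apply: hilbert_orIr].
Qed.

Lemma hilbert_dep0E Gamma i theta : hilbert Gamma (FDep [::] i) ->
  hilbert (FVar i |` Gamma) theta -> hilbert (fneg (FVar i) |` Gamma) theta ->
  hilbert Gamma theta.
Proof.
move=> h; apply: hilbert_orE; apply: hilbert_mp h.
by apply: hilbert_andEl; apply: hilbert_ax (PID_dep0 i).
Qed.

Lemma hilbert_depI Gamma ks j :
  hilbert ([set FDep [::] i | i in [set` ks]] `|` Gamma) (FDep [::] j) ->
  hilbert Gamma (FDep ks j).
Proof.
case: ks => [|i ks] h.
  by apply: hilbert_weaken h => psi [[]|].
set C := big_and (FDep [::] i) [seq FDep [::] x | x <- ks].
apply: (hilbert_mp (phi := FImp C (FDep [::] j))).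
  apply: hilbert_andEr; apply: hilbert_ax (PID_dep i ks j).
  by rewrite /= in_PID_big_and_dep.
have lC : in_PID C by apply: in_PID_big_and_dep.
apply: hilbert_impI => //; apply: hilbert_subst h _ => psi lpsi [|Gpsi].
  move=> [k kin <-]; apply: (hilbert_big_and_dep _ _ _).1 kin.
  exact: hilbert_hyp1.
by apply: hilbert_hyp => //; right.
Qed.

Lemma hilbert_depE Gamma ks j : hilbert Gamma (FDep ks j) ->
  (forall i, i \in ks -> hilbert Gamma (FDep [::] i)) ->
  hilbert Gamma (FDep [::] j).
Proof.
case: ks => [|i ks] h // /hilbert_big_and_dep; apply: hilbert_mp.
apply: hilbert_mp h; apply: hilbert_andEl; apply: hilbert_ax (PID_dep i ks j).
by rewrite /= in_PID_big_and_dep.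
Qed.

Lemma hilbert_dnI Gamma phi :
  hilbert Gamma phi -> hilbert Gamma (fneg (fneg phi)).
Proof.
move=> h; have lphi := hilbert_lang h.
apply: hilbert_impI; first by rewrite /= lphi.
apply: hilbert_mp (hilbert_weaken1 _ h); apply: hilbert_hyp1.
by rewrite /= lphi.
Qed.

(** Stability under double negation is an axiom for variables only. It passes to [FBot], to
    conjunctions and to implications with stable conclusion, which exhausts the flat formulas of
    PID. *)
Lemma hilbert_dnE Gamma alpha : flat alpha ->
  hilbert Gamma (fneg (fneg alpha)) -> hilbert Gamma alpha.
Proof.
have dn_mono G phi psi : in_PID phi -> hilbert (phi |` G) psi ->
    hilbert G (fneg (fneg phi)) -> hilbert G (fneg (fneg psi)).
  move=> lphi hpsi h; have lpsi := hilbert_lang hpsi.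
  have lnpsi : in_PID (fneg psi) by rewrite /= lpsi.
  apply: hilbert_impI => //; apply: hilbert_mp (hilbert_weaken1 _ h) _.
  apply: hilbert_impI => //.
  apply: hilbert_mp (hilbert_weaken1 _ (hilbert_hyp1 _ lnpsi)) _.
  by apply: hilbert_weaken hpsi; apply: setUS; apply: subsetUr.
elim: alpha Gamma => [i|i||//|phi IHphi psi IHpsi|phi _ psi _|//
  |phi IHphi psi IHpsi] Gamma /= falpha h; have /= := hilbert_lang h.
- by move=> _; apply: hilbert_mp h; apply: hilbert_ax (PID_dne i).
- by [].
- by move=> _; apply: hilbert_mp h _; apply: hilbert_id.
- rewrite !andbT => /andP[lphi lpsi]; have [fphi fpsi] := andP falpha.
  have lc : in_PID (FAnd phi psi) by rewrite /= lphi lpsi.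
  apply: hilbert_andI; [apply: IHphi => //|apply: IHpsi => //];
    apply: dn_mono h => //.
    exact: hilbert_andEl (hilbert_hyp1 _ lc).
  exact: hilbert_andEr (hilbert_hyp1 _ lc).
- by [].
- rewrite !andbT => /andP[lphi lpsi]; have [fphi fpsi] := andP falpha.
  have lc : in_PID (FImp phi psi) by rewrite /= lphi lpsi.
  apply: hilbert_impI => //; apply: IHpsi => //.
  apply: dn_mono (hilbert_weaken1 _ h) => //.
  apply: hilbert_mp (hilbert_hyp1 _ lc) _; apply: hilbert_weaken1.
  exact: hilbert_hyp1.
Qed.

(** * Resolutions in the Hilbert system *)

(* The split axiom applies because flat formulas are equivalent to their double
   negations. *)
Lemma hilbert_imp_split Gamma alpha psi B theta : flat alpha ->
  0 < size B -> (forall b, b \in B -> in_PID b && flat b) ->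
  (forall Delta chi, hilbert Delta psi ->
     (forall b, b \in B -> hilbert (b |` Delta) chi) -> hilbert Delta chi) ->
  hilbert Gamma (FImp alpha psi) ->
  (forall b, b \in B -> hilbert (FImp alpha b |` Gamma) theta) ->
  hilbert Gamma theta.
Proof.
case: B => // b0 B falpha _ hB elimB h hres.
have /= /andP[lalpha lpsi] := hilbert_lang h.
have lnn x : in_PID x -> in_PID (fneg (fneg x)) by move=> /= ->.
set na := fneg alpha.
have lB b : b \in b0 :: B -> in_PID b by move=> /hB /andP[].
have lall : all in_PID [seq fneg (fneg b) | b <- b0 :: B].
  by apply/allP => _ /mapP[b bin ->]; apply: lnn; apply: lB.
have lall' : all in_PID [seq FImp (fneg na) (fneg (fneg b)) | b <- b0 :: B].
  apply/allP => _ /mapP[b bin ->].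
  by have := lB _ bin; rewrite /= lalpha => ->.
have lor x s : all in_PID (x :: s) -> in_PID (big_or x s).
  elim: s x => [|y s IH] x /= /andP[-> //]; exact: IH.
have h1 : hilbert Gamma (FImp (fneg na)
    (big_or (fneg (fneg b0)) [seq fneg x | x <- [seq fneg b | b <- B]])).
  apply: hilbert_impI; first exact: lnn.
  apply: (elimB _ _ (hilbert_mp (hilbert_weaken1 _ h)
    (hilbert_dnE falpha (hilbert_hyp1 _ (lnn _ lalpha))))) => b bin.
  rewrite -map_comp.
  apply: hilbert_big_orI (hilbert_dnI (hilbert_hyp1 _ (lB _ bin))).
    exact: lall.
  exact: (map_f (fun b => fneg (fneg b)) bin).
have h2 : hilbert Gamma (big_or (FImp (fneg na) (fneg (fneg b0)))
    [seq FImp (fneg na) (fneg x) | x <- [seq fneg b | b <- B]]).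
  apply: hilbert_mp (h1); apply: hilbert_ax (PID_split _ _ _).
  rewrite /= in h1 *; have /= -> := hilbert_lang h1.
  by rewrite -map_comp; apply: lor; exact: lall'.
apply: hilbert_big_orE h2 _ => chi; rewrite -map_comp.
pose f b := FImp (fneg na) (fneg (fneg b)).
move=> /(@mapP _ _ f (b0 :: B))[b bin ->].
have /andP[lb fb] := hB _ bin.
have lc : in_PID (FImp (fneg na) (fneg (fneg b))) by rewrite /= lalpha lb.
apply: (hilbert_cut (phi := FImp alpha b)); last first.
  apply: hilbert_weaken (hres _ bin); apply: setUS; exact: subsetUr.
apply: hilbert_impI => //; apply: hilbert_dnE => //.
apply: hilbert_mp (hilbert_weaken1 _ (hilbert_hyp1 _ lc)) _.
by apply: hilbert_dnI; apply: hilbert_hyp1.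
Qed.

Lemma hilbert_dep_case Gamma i ks j :
  hilbert Gamma (FDep (i :: ks) j) ->
  hilbert Gamma (dep_case PID i (FDep ks j) (FDep ks j)).
Proof.
move=> h.
have D chi : in_PID chi -> hilbert (chi |` Gamma) (FDep [::] i) ->
    hilbert Gamma (FImp chi (FDep ks j)).
  move=> lchi hi; apply: hilbert_impI => //; apply: hilbert_depI.
  apply: (@hilbert_depE _ (i :: ks)).
    by apply: hilbert_weaken h => psi ?; right; right.
  move=> k; rewrite in_cons => /orP[/eqP->|kks].
    by apply: hilbert_weaken hi; apply: subsetUr.
  by apply: hilbert_hyp => //; left; exists k.
apply: hilbert_andI; apply: D => //; apply: hilbert_dep0I; [left|right];
  exact: hilbert_hyp1.
Qed.

Lemma hilbert_dep_caseE Gamma i ks j :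
  hilbert Gamma (dep_case PID i (FDep ks j) (FDep ks j)) ->
  hilbert Gamma (FDep (i :: ks) j).
Proof.
move=> h; apply: hilbert_depI; set Gamma' := _ `|` Gamma.
have {}h : hilbert Gamma' (dep_case PID i (FDep ks j) (FDep ks j)).
  by apply: hilbert_weaken h; apply: subsetUr.
have hk k : k \in i :: ks -> hilbert Gamma' (FDep [::] k).
  by move=> kin; apply: hilbert_hyp => //; left; exists k.
have E chi : hilbert (chi |` Gamma') (FDep ks j) ->
    hilbert (chi |` Gamma') (FDep [::] j).
  move=> hD; apply: hilbert_depE hD _ => k kks; apply: hilbert_weaken1.
  by apply: hk; rewrite in_cons kks orbT.
apply: (hilbert_dep0E (i := i)); first by apply: hk; rewrite mem_head.
- apply: E; apply: hilbert_mp (hilbert_hyp1 _ _) => //.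
  exact: hilbert_weaken1 (hilbert_andEl h).
- apply: E; apply: hilbert_mp (hilbert_hyp1 _ _) => //.
  exact: hilbert_weaken1 (hilbert_andEr h).
Qed.

Lemma hilbert_dep_res Gamma ks j alpha : alpha \in dep_res PID ks j ->
  hilbert Gamma alpha -> hilbert Gamma (FDep ks j).
Proof.
elim: ks alpha Gamma => [|i ks IH] alpha Gamma.
  by rewrite !inE => /orP[]/eqP-> h; apply: hilbert_dep0I; [left|right].
move=> /allpairsP[[a b] /= [ain bin ->]] h; apply: hilbert_dep_caseE.
have /= /andP[la lb] := hilbert_lang h.
apply: hilbert_andI; apply: hilbert_impI => //.
  apply: IH ain _; apply: hilbert_mp (hilbert_hyp1 _ _) => //.
  exact: hilbert_weaken1 (hilbert_andEl h).
apply: IH bin _; apply: hilbert_mp (hilbert_hyp1 _ _) => //.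
exact: hilbert_weaken1 (hilbert_andEr h).
Qed.

(** Both implications in the expansion over p_i have flat antecedents, so the choice of a resolution
    for the shorter atom can be pulled in front of each; the induction hypothesis is exactly the
    elimination principle that this requires. *)
Lemma hilbert_dep_res_elim Gamma ks j theta : hilbert Gamma (FDep ks j) ->
  (forall alpha, alpha \in dep_res PID ks j ->
     hilbert (alpha |` Gamma) theta) ->
  hilbert Gamma theta.
Proof.
elim: ks Gamma theta => [|i ks IH] Gamma theta h /= hres.
  by apply: hilbert_dep0E h _ _; apply: hres; rewrite !inE eqxx ?orbT.
have {}h := hilbert_dep_case h.
have size0 : 0 < size (dep_res PID ks j) := res_size_gt0 PID (FDep ks j).
have resflat b := @res_flat PID (FDep ks j) b isT.
apply: (hilbert_imp_split (alpha := FVar i) isT size0 resflat IH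
  (hilbert_andEl h)) => a ain.
have /andP[/= la _] := resflat _ ain.
apply: (hilbert_imp_split (alpha := fneg (FVar i)) isT size0 resflat IH
  (hilbert_weaken1 _ (hilbert_andEr h))) => b bin.
have /andP[/= lb _] := resflat _ bin.
apply: (hilbert_cut (phi := dep_case PID i a b)).
  apply: hilbert_andI; last by apply: hilbert_hyp1; rewrite /= lb.
  by apply: hilbert_weaken1; apply: hilbert_hyp1; rewrite /= la.
apply: hilbert_weaken (hres _ (allpairs_f _ ain bin)); apply: setUS.
by move=> x Gx; right; right.
Qed.

Lemma hilbert_imp_res Gamma A B a c : a \in A -> c \in imp_res A B ->
  hilbert Gamma c -> exists2 b, b \in B & hilbert Gamma (FImp a b).
Proof.
elim: A c => //= a' A IH c + /allpairsP[[b d] /= [bin din ->]] h.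
rewrite in_cons => /orP[/eqP->|ain].
  by exists b => //; apply: hilbert_andEl h.
exact: IH ain din (hilbert_andEr h).
Qed.

(** The choice function is built one argument at a time: splitting the implication from [a] to [psi]
    fixes its value at [a], and the induction hypothesis treats the rest of [A]. *)
Lemma hilbert_imp_res_elim Gamma A B psi theta :
  (forall a, a \in A -> in_PID a && flat a) ->
  0 < size B -> (forall b, b \in B -> in_PID b && flat b) ->
  (forall Delta chi, hilbert Delta psi ->
     (forall b, b \in B -> hilbert (b |` Delta) chi) -> hilbert Delta chi) ->
  (forall a, a \in A -> hilbert Gamma (FImp a psi)) ->
  (forall c, c \in imp_res A B -> hilbert (c |` Gamma) theta) ->
  hilbert Gamma theta.
Proof.
move=> hA B0 hB elimB; elim: A Gamma hA => [|a A IH] Gamma hA himp hres.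
  apply: hilbert_cut (hres _ (mem_head _ _)); exact: hilbert_id.
have /andP[la fa] := hA _ (mem_head _ _).
apply: (hilbert_imp_split fa B0 hB elimB (himp _ (mem_head _ _))) => b bin.
have /andP[lb _] := hB _ bin.
have lab : in_PID (FImp a b) by rewrite /= la lb.
apply: IH => [x xA|x xA|c cin].
- by apply: hA; rewrite in_cons xA orbT.
- by apply: hilbert_weaken1; apply: himp; rewrite in_cons xA orbT.
apply: hilbert_subst (hres (FAnd (FImp a b) c) (allpairs_f _ bin cin)) _.
move=> psi' lpsi' [E|Gpsi']; last by apply: hilbert_hyp => //; right; right.
rewrite E; rewrite E /= in lpsi'; have /andP[_ lc] := lpsi'.
apply: hilbert_andI; last exact: hilbert_hyp1.
by apply: hilbert_weaken1; apply: hilbert_hyp1.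
Qed.

(** The two halves are proved together because implication swaps their roles on the antecedent:
    introducing an implication eliminates resolutions of [phi], and eliminating one introduces [phi]
    from its resolutions. *)
Lemma hilbert_res phi : in_PID phi ->
  (forall Gamma alpha, alpha \in res PID phi -> hilbert Gamma alpha ->
     hilbert Gamma phi) /\
  (forall Gamma theta, hilbert Gamma phi ->
     (forall alpha, alpha \in res PID phi -> hilbert (alpha |` Gamma) theta) ->
     hilbert Gamma theta).
Proof.
elim: phi => [i|//||ks j|phi IHphi psi IHpsi|//|phi IHphi psi IHpsi
  |phi IHphi psi IHpsi] /=.
- move=> _; split=> Gamma theta; first by rewrite mem_seq1 => /eqP->.
  by move=> h /(_ _ (mem_head _ _)); apply: hilbert_cut.
- move=> _; split=> Gamma theta; first by rewrite mem_seq1 => /eqP->.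
  by move=> h /(_ _ (mem_head _ _)); apply: hilbert_cut.
- move=> _; split=> Gamma theta; first exact: hilbert_dep_res.
  exact: hilbert_dep_res_elim.
- move=> /andP[lphi lpsi].
  have [introphi elimphi] := IHphi lphi; have [intropsi elimpsi] := IHpsi lpsi.
  split=> Gamma theta.
    move=> /allpairsP[[a b] /= [ain bin ->]] h; apply: hilbert_andI.
      exact: introphi ain (hilbert_andEl h).
    exact: intropsi bin (hilbert_andEr h).
  move=> h hres; apply: elimphi (hilbert_andEl h) _ => a ain.
  apply: elimpsi (hilbert_weaken1 _ (hilbert_andEr h)) _ => b bin.
  have /andP[/= la _] := @res_flat PID _ _ lphi ain.
  have /andP[/= lb _] := @res_flat PID _ _ lpsi bin.
  apply: (hilbert_cut (phi := FAnd a b)).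
    apply: hilbert_andI; last exact: hilbert_hyp1.
    by apply: hilbert_weaken1; apply: hilbert_hyp1.
  apply: hilbert_weaken (hres _ (allpairs_f _ ain bin)); apply: setUS.
  by move=> x Gx; right; right.
- move=> /andP[lphi lpsi].
  have [introphi elimphi] := IHphi lphi; have [intropsi elimpsi] := IHpsi lpsi.
  split=> Gamma theta.
    rewrite mem_cat => /orP[ain|ain] h.
      by apply: hilbert_orIl => //; apply: introphi ain h.
    by apply: hilbert_orIr => //; apply: intropsi ain h.
  move=> h hres; apply: hilbert_orE h _ _.
    apply: elimphi (hilbert_hyp1 _ lphi) _ => a ain.
    apply: hilbert_weaken (hres a _); last by rewrite mem_cat ain.
    by apply: setUS; apply: subsetUr.
  apply: elimpsi (hilbert_hyp1 _ lpsi) _ => a ain.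
  apply: hilbert_weaken (hres a _); last by rewrite mem_cat ain orbT.
  by apply: setUS; apply: subsetUr.
- move=> /andP[lphi lpsi].
  have [introphi elimphi] := IHphi lphi; have [intropsi elimpsi] := IHpsi lpsi.
  split=> Gamma theta.
    move=> cin h; apply: hilbert_impI => //.
    apply: elimphi (hilbert_hyp1 _ lphi) _ => a ain.
    have /andP[/= la _] := @res_flat PID _ _ lphi ain.
    have h' := hilbert_weaken1 a (hilbert_weaken1 phi h).
    have [b bin hb] := hilbert_imp_res ain cin h'.
    exact: intropsi bin (hilbert_mp hb (hilbert_hyp1 _ la)).
  move=> h; apply: (hilbert_imp_res_elim _ (res_size_gt0 _ _) _ elimpsi).
  + by move=> a; apply: (@res_flat PID).
  + by move=> a; apply: (@res_flat PID).
  move=> a ain; have /andP[/= la _] := @res_flat PID _ _ lphi ain.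
  apply: hilbert_impI => //; apply: hilbert_mp (hilbert_weaken1 _ h) _.
  exact: introphi ain (hilbert_hyp1 _ la).
Qed.

(** * Completeness *)

Lemma derives_res L Gamma phi alpha : in_lang L phi ->
  alpha \in res L phi -> derives L Gamma alpha -> derives L Gamma phi.
Proof.
case: L => /= lphi.
- exact: nd_res_intro.
- exact: nd_res_intro.
- exact: (hilbert_res lphi).1.
Qed.

Lemma derives_res_elim L Gamma phi theta : derives L Gamma phi ->
  (forall alpha, alpha \in res L phi -> derives L (alpha |` Gamma) theta) ->
  derives L Gamma theta.
Proof.
case: L => /= h.
- exact: nd_res_elim h.
- exact: nd_res_elim h.
- exact: (hilbert_res (hilbert_lang h)).2 h.
Qed.

Lemma derives_sat_res L phi X : in_lang L phi -> sat X phi ->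
  exists2 alpha, alpha \in res L phi & sat X alpha.
Proof.
case: L => [||lphi]; [exact: sat_res|exact: sat_res|].
have := @res_flat PID phi ^~ lphi; have := res_size_gt0 PID phi.
case resE : (res PID phi) => [//|a A] _ Aflat satphi; apply/sat_big_or.
(* PID can express the disjunction of the resolutions, so soundness of its derivation from [phi]
   makes one of them true on the team. *)
have h : hilbert [set phi] (big_or a A).
  apply: (hilbert_res lphi).2; first exact: hilbert_hyp.
  rewrite resE => b bin; have /andP[/= lb _] := Aflat b bin.
  apply: hilbert_big_orI bin (hilbert_hyp1 _ lb).
  by apply/allP => c /Aflat /andP[].
by apply: hilbert_sound h _ _ => psi ->.
Qed.

Lemma derives_cut L Gamma phi psi :
  derives L Gamma phi -> derives L (phi |` Gamma) psi -> derives L Gamma psi.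
Proof. by case: L; [exact: nd_cut|exact: nd_cut|exact: hilbert_cut]. Qed.

Lemma derives_weaken L Gamma Delta phi :
  Gamma `<=` Delta -> derives L Gamma phi -> derives L Delta phi.
Proof.
by case: L; [exact: nd_weaken|exact: nd_weaken|exact: hilbert_weaken].
Qed.

Lemma derives_hyp L Gamma phi :
  in_lang L phi -> Gamma phi -> derives L Gamma phi.
Proof. by case: L; [exact: nd_hyp|exact: nd_hyp|exact: hilbert_hyp]. Qed.

Lemma derives_compact L Gamma F phi : F !=set0 -> total_on F subset ->
  derives L (Gamma `|` \bigcup_(A in F) A) phi ->
  exists2 A, F A & derives L (Gamma `|` A) phi.
Proof.
by case: L; [exact: nd_compact|exact: nd_compact|exact: hilbert_compact].
Qed.

Lemma derives_exfalso L Gamma phi :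
  in_lang L phi -> derives L Gamma FBot -> derives L Gamma phi.
Proof.
by case: L; [exact: nd_exfalso|exact: nd_exfalso|exact: hilbert_botE].
Qed.

(** Flatness licenses the case analysis: in PD and PDv the conclusion is classical, as weak
    elimination from excluded middle demands, and in PID it is stable under double negation. *)
Lemma derives_var_cases L Gamma i alpha : in_lang L alpha -> flat alpha ->
  derives L (FVar i |` Gamma) alpha -> derives L (neg_var L i |` Gamma) alpha ->
  derives L Gamma alpha.
Proof.
move=> lalpha falpha.
case: L lalpha => lalpha /= h1 h2.
- apply: nd_tensorE (nd_em _ _ i) h1 h2; exact: flat_classical lalpha falpha.
- apply: nd_tensorE (nd_em _ _ i) h1 h2; exact: flat_classical lalpha falpha.
apply: hilbert_dnE => //.
have lna : in_PID (fneg alpha) by rewrite /= andbT.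
have N chi : in_PID chi -> hilbert (chi |` Gamma) alpha ->
    hilbert (fneg alpha |` Gamma) (fneg chi).
  move=> lchi h; apply: hilbert_impI => //.
  apply: hilbert_mp (hilbert_weaken1 _ (hilbert_hyp1 _ lna)) _.
  by apply: hilbert_weaken h; apply: setUS; apply: subsetUr.
by apply: hilbert_impI => //; apply: hilbert_mp (N _ _ h2) (N _ _ h1).
Qed.

Lemma lindenbaum L Gamma phi : ~ derives L Gamma phi ->
  exists Delta, [/\ Gamma `<=` Delta, ~ derives L Delta phi &
    forall psi, ~ Delta psi -> derives L (psi |` Delta) phi].
Proof.
move=> nphi.
(* Zorn's lemma is applied to the sets added to [Gamma] and not to supersets of [Gamma], so that the
   empty union, arising from the empty chain, is admissible too. *)
have [|A [nA maxA]] := @Zorn_bigcup _ [set A | ~ derives L (Gamma `|` A) phi].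
  move=> F FP Ftot /= h.
  have [F0|/set0P F0] := eqVneq F set0.
    by apply: nphi; move: h; rewrite F0 bigcup_set0 setU0.
  have [A FA hA] := derives_compact F0 Ftot h.
  exact: FP FA hA.
exists (Gamma `|` A); split=> //.
move=> psi npsi; apply: contrapT => n.
apply: (maxA (psi |` A)); last by rewrite /= setUCA.
split; first exact: subsetUr.
by move=> /(_ psi (or_introl erefl)) Apsi; apply: npsi; right.
Qed.

Lemma sat_point_var s i : sat [set s] (FVar i) <-> s i = true.
Proof. by split=> [|si _ ->//]; apply. Qed.

Lemma sat_point_neg_var s i : sat [set s] (FNegVar i) <-> s i = false.
Proof. by split=> [|si _ ->//]; apply. Qed.

Lemma derives_contra L Gamma i : derives L Gamma (FVar i) ->
  derives L Gamma (neg_var L i) -> derives L Gamma FBot.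
Proof.
case: L => /= h h'; last exact: hilbert_mp h' h.
- by apply: (nd_contra (i := i)); apply: nd_andI.
- by apply: (nd_contra (i := i)); apply: nd_andI.
Qed.

Lemma derives_andI L Gamma phi psi : derives L Gamma phi ->
  derives L Gamma psi -> derives L Gamma (FAnd phi psi).
Proof. by case: L; [exact: nd_andI|exact: nd_andI|exact: hilbert_andI]. Qed.

Lemma derives_andE L Gamma phi psi : derives L Gamma (FAnd phi psi) ->
  derives L Gamma phi /\ derives L Gamma psi.
Proof.
by case: L => /= h; split; move: h;
  [exact: nd_andEl|exact: nd_andEr|exact: nd_andEl|exact: nd_andEr
  |exact: hilbert_andEl|exact: hilbert_andEr].
Qed.

(** Kalmar's argument: literals agreeing with [s] decide every flat formula as [s] does. Falsity is
    expressed as inconsistency with [alpha] because PD and PDv negate only variables. *)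
Lemma derives_decide L Gamma s alpha :
  (forall i, derives L Gamma (if s i then FVar i else neg_var L i)) ->
  in_lang L alpha -> flat alpha ->
  (sat [set s] alpha -> derives L Gamma alpha) /\
  (~ sat [set s] alpha -> derives L (alpha |` Gamma) FBot).
Proof.
move=> lits; have hyp1 chi : in_lang L chi -> derives L (chi |` Gamma) chi.
  by move=> lchi; apply: derives_hyp => //; left.
have weaken1 chi psi : derives L Gamma psi -> derives L (chi |` Gamma) psi.
  by apply: derives_weaken; apply: subsetUr.
have repl chi psi theta : derives L (chi |` Gamma) psi ->
    derives L (psi |` Gamma) theta -> derives L (chi |` Gamma) theta.
  move=> h h'; apply: derives_cut h _; apply: derives_weaken h'.
  by apply: setUS; apply: subsetUr.
elim: alpha => [i|i||//|phi IHphi psi IHpsi|phi IHphi psi IHpsi|//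
  |phi IHphi psi IHpsi] lalpha falpha.
- have := lits i; case si: (s i) => h; split=> hs //.
  + by case: hs; apply/sat_point_var.
  + by move/sat_point_var: hs; rewrite si.
  + by apply: derives_contra (hyp1 _ lalpha) (weaken1 _ _ h).
- have negE : neg_var L i = FNegVar i by case: (L) lalpha.
  have := lits i; rewrite negE; case si: (s i) => h; split=> hs //.
  + by move/sat_point_neg_var: hs; rewrite si.
  + by apply: derives_contra (weaken1 _ _ h) _; rewrite negE; apply: hyp1.
  + by case: hs; apply/sat_point_neg_var.
- split=> [hs|_]; last exact: hyp1.
  by have : [set s] s by []; rewrite hs.
- have /andP[lphi lpsi] : in_lang L phi && in_lang L psi by case: (L) lalpha.
  have [fphi fpsi] := andP falpha.
  have [Tphi Fphi] := IHphi lphi fphi; have [Tpsi Fpsi] := IHpsi lpsi fpsi.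
  split=> [[/Tphi h /Tpsi h']|nsat]; first exact: derives_andI.
  have [h h'] := derives_andE (hyp1 _ lalpha).
  have [satphi|/Fphi] := pselect (sat [set s] phi); last exact: repl.
  by apply: repl h' (Fpsi _) => satpsi; apply: nsat.
- have LnPID : L <> PID by move=> LE; move: lalpha; rewrite LE.
  have /andP[lphi lpsi] : in_lang L phi && in_lang L psi.
    by rewrite -in_lang_tensor.
  have dE G chi : derives L G chi = nd L G chi by case: (L) LnPID.
  have [fphi fpsi] := andP falpha.
  have [Tphi Fphi] := IHphi lphi fphi; have [Tpsi Fpsi] := IHpsi lpsi fpsi.
  move: Tphi Fphi Tpsi Fpsi (hyp1 _ lalpha).
  rewrite !dE => Tphi Fphi Tpsi Fpsi h.
  split=> [/sat_point_tensor[/Tphi h'|/Tpsi h']|nsat].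
  + exact: nd_tensorIl.
  + exact: nd_tensorIr.
  (* Weak elimination is available because its conclusion [FBot] is classical. *)
  apply: nd_tensorE h _ _ => //.
    apply: nd_weaken (Fphi _); first by apply: setUS; apply: subsetUr.
    by move=> ?; apply: nsat; apply/sat_point_tensor; left.
  apply: nd_weaken (Fpsi _); first by apply: setUS; apply: subsetUr.
  by move=> ?; apply: nsat; apply/sat_point_tensor; right.
- have LE : L = PID by case: (L) lalpha.
  move: lalpha hyp1 weaken1 repl IHphi IHpsi.
  rewrite LE => /= /andP[lphi lpsi] hyp1 weaken1 repl IHphi IHpsi.
  have [fphi fpsi] := andP falpha.
  have [Tphi Fphi] := IHphi lphi fphi; have [Tpsi Fpsi] := IHpsi lpsi fpsi.
  split=> [/sat_point_imp h|nsat].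
    apply: hilbert_impI => //.
    have [satphi|/Fphi] := pselect (sat [set s] phi).
      by apply: weaken1; apply: Tpsi; apply: h.
    exact: hilbert_botE.
  have satphi : sat [set s] phi.
    by apply: contrapT => n; apply: nsat; apply/sat_point_imp => /n.
  have nsatpsi : ~ sat [set s] psi.
    by move=> satpsi; apply: nsat; apply/sat_point_imp.
  apply: repl (Fpsi nsatpsi).
  apply: hilbert_mp (weaken1 _ _ (Tphi satphi)); apply: hyp1.
  by rewrite /= lphi.
Qed.

(** The extension is maximal for the flat goal [alpha]. If it omitted both p_i and its negation,
    either one would yield [alpha], and case analysis on p_i would derive it; so it decides every
    variable and determines a valuation. *)
Lemma flat_completeness L Gamma alpha : in_lang L alpha -> flat alpha ->
  (forall s, (forall beta, Gamma beta -> in_lang L beta -> flat beta ->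
     sat [set s] beta) -> sat [set s] alpha) ->
  derives L Gamma alpha.
Proof.
move=> lalpha falpha h; apply: contrapT => /lindenbaum[Delta [GD nD maxD]].
pose s i : bool := `[< Delta (FVar i) >].
have lneg i : in_lang L (FVar i) /\ in_lang L (neg_var L i) by case: (L).
have lits i : derives L Delta (if s i then FVar i else neg_var L i).
  rewrite /s; case: asboolP => [?|np].
    by apply: derives_hyp => //; exact: (lneg i).1.
  apply: derives_hyp; first exact: (lneg i).2.
  apply: contrapT => nn; apply: nD.
  exact: (derives_var_cases lalpha falpha (maxD _ np) (maxD _ nn)).
apply: (nD); apply: (derives_decide lits lalpha falpha).1.
apply: h => beta Gbeta lbeta fbeta; apply: contrapT.
move=> /(derives_decide lits lbeta fbeta).2 hbot; apply: nD.
apply: derives_exfalso => //; apply: derives_cut hbot.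
exact: derives_hyp (GD _ Gbeta).
Qed.

Theorem theorem1p8 (L : logic) (Gamma : set form) (phi : form)
  (hGamma : forall psi, Gamma psi -> in_lang L psi) (hphi : in_lang L phi) :
  derives L Gamma phi <-> entails Gamma phi.
Proof.
split=> [|entl]; first exact: derives_sound.
apply: contrapT => /lindenbaum[Delta [GD nD maxD]].
have Dres psi : in_lang L psi -> Delta psi ->
    exists2 alpha, alpha \in res L psi & Delta alpha.
  move=> lpsi Dpsi; apply: contrapT => n; apply: nD.
  apply: derives_res_elim (derives_hyp lpsi Dpsi) _ => alpha ain.
  by apply: maxD => Dalpha; apply: n; exists alpha.
(* The restriction to the language is essential: maximality puts every formula outside the language
   into [Delta], contradictory flat ones included, and these would make [X] empty. *)
pose X : team := [set s | forall alpha, Delta alpha -> in_lang L alpha ->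
  flat alpha -> sat [set s] alpha].
have satX : sat X phi.
  apply: entl => psi Gpsi; have lpsi := hGamma _ Gpsi.
  have [alpha ain Dalpha] := Dres _ lpsi (GD _ Gpsi).
  have /andP[lalpha falpha] := res_flat lpsi ain.
  (* Flatness makes [alpha] true on [X]; soundness of this derivation then transfers truth from the
     resolution to [psi]. *)
  have h : derives L [set alpha] psi.
    by apply: derives_res ain _ => //; apply: derives_hyp.
  apply: derives_sound h _ _ => _ ->; apply: sat_flat => // s Xs.
  exact: Xs.
have [alpha ain satalpha] := derives_sat_res hphi satX.
have /andP[lalpha falpha] := res_flat hphi ain.
apply: nD; apply: derives_res ain _ => //; apply: flat_completeness => // s hs.
exact: sat_point satalpha.
Qed.
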